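(* Assume the Exponential Time Hypothesis (ETH). Then there is no algorithm that solves the $k$-RTD problem in time $n^{o(\log n)}$, where $n = |\mathcal{C}|\cdot|X|$ is the input size.
   Context: A concept over a finite domain $X$ is a function $c: X\to\{0,1\}$; a concept class $\mathcal{C}$ is a set of concepts. For $S\subseteq X$, $c|_S$ denotes the restriction of $c$ to $S$. A teaching set of $c\in\mathcal{C}$ w.r.t. $\mathcal{C}$ is a set $S\subseteq X$ such that $c|_S\neq c'|_S$ for every $c'\in\mathcal{C}\setminus\{c\}$; $\mathrm{TS}(c,\mathcal{C})$ is the minimum size of such a set. A teaching plan for $\mathcal{C}$ is a sequence $(c_1,S_1),\dots,(c_m,S_m)$ with $\mathcal{C}=\{c_1,\dots,c_m\}$ (distinct) such that for each $i$, $S_i$ is a teaching set of $c_i$ w.r.t. $\{c_i,\dots,c_m\}$. The recursive teaching dimension $\mathrm{RTD}(\mathcal{C})$ is the minimum over all teaching plans of $\max_i |S_i|$. In the $k$-RTD problem, the input is a concept class $\mathcal{C}$ given explicitly as a Boolean matrix $M\in\{0,1\}^{\mathcal{C}\times X}$ with $M_{c,x}=c(x)$, together with an integer $k$, and the task is to decide whether $\mathrm{RTD}(\mathcal{C})\le k$. ETH: 3SAT on $n$ variables cannot be solved in time $2^{o(n)}$. *)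

(* Defs.v *)
From mathcomp Require Import all_boot.
Set Implicit Arguments.
Unset Strict Implicit.
Unset Printing Implicit Defensive.

Inductive letter := L0 | L1 | LS | LT.

(* ---------- Turing machines ----------
   States 'I_((tm_q M).+1) (start state ord0), tape symbols 'I_((tm_g M).+4.+1)
   (symbol 0 = blank, symbols 1..4 = the input letters).  delta returning
   None means the machine halts; its answer is then acc of the current state.
   A transition writes a symbol and moves right (true) or left (false). *)
Record TM := MkTM {
  tm_q : nat;
  tm_g : nat;
  tm_delta : 'I_(tm_q.+1) -> 'I_(tm_g.+4.+1) ->
             option ('I_(tm_q.+1) * 'I_(tm_g.+4.+1) * bool);
  tm_acc : 'I_(tm_q.+1) -> bool }.

Section TMSemantics.
Variable M : TM.
Local Notation St := 'I_((tm_q M).+1).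
Local Notation Sym := 'I_((tm_g M).+4.+1).

(* configuration: state, left tape (nearest cell first), head cell, right tape *)
Definition config := (St * seq Sym * Sym * seq Sym)%type.

Definition blank : Sym := inord 0.
Definition code (a : letter) : Sym :=
  match a with L0 => inord 1 | L1 => inord 2 | LS => inord 3 | LT => inord 4 end.

Definition step (c : config) : option config :=
  let: (s, l, h, r) := c in
  match tm_delta s h with
  | None => None
  | Some (s', w, true) =>
      Some (match r with
            | [::] => (s', w :: l, blank, [::])
            | a :: r' => (s', w :: l, a, r') end)
  | Some (s', w, false) =>
      Some (match l with
            | [::] => (s', [::], blank, w :: r)
            | a :: l' => (s', l', a, w :: r) end)
  end.

Fixpoint out_within (t : nat) (c : config) : option bool :=
  match step c with
  | None => let: (s, _, _, _) := c in Some (@tm_acc M s)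
  | Some c' => match t with 0 => None | t'.+1 => out_within t' c' end
  end.

Definition init (w : seq letter) : config :=
  match w with
  | [::] => (ord0, [::], blank, [::])
  | a :: w' => (ord0, [::], code a, map code w')
  end.
End TMSemantics.

Definition decides_within (I : Type) (M : TM) (f : nat -> nat)
  (valid : I -> Prop) (enc : I -> seq letter) (sz : I -> nat) (P : I -> Prop) :=
  forall i, valid i ->
    exists b, @out_within M (f (sz i)) (@init M (enc i)) = Some b /\ (b = true <-> P i).

(* T(n) = 2^{o(n)} : for every c > 0, eventually T(n) <= 2^{n/c}. *)
Definition subexp (T : nat -> nat) :=
  forall c, 0 < c -> exists N, forall n, N <= n -> T n ^ c <= 2 ^ n.

(* f(n) = n^{o(log n)} = 2^{o(log^2 n)} : for every c > 0, eventually
   f(n) <= 2^{(log n)^2 / c}. *)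
Definition quasi_sub (f : nat -> nat) :=
  forall c, 0 < c -> exists N, forall n, N <= n ->
    f n ^ c <= 2 ^ (trunc_log 2 n ^ 2).

(* A 3-CNF formula: number of variables v, and a list of clauses (pairwise
   distinct), each a list of at most 3 literals (sign, variable index < v). *)
Definition cnf := (nat * seq (seq (bool * nat)))%type.

Definition wf_cnf (F : cnf) : Prop :=
  uniq F.2 /\
  all (fun cl => (size cl <= 3) && all (fun l => l.2 < F.1) cl) F.2.

Definition sat (F : cnf) : Prop :=
  exists a : nat -> bool, all (fun cl => has (fun l => a l.2 == l.1) cl) F.2.

Definition bit (b : bool) : letter := if b then L1 else L0.

Definition enc_cnf (F : cnf) : seq letter :=
  nseq F.1 L1 ++ LT ::
  flatten [seq flatten [seq bit l.1 :: nseq l.2 L1 ++ [:: LS] | l <- cl]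
                 ++ [:: LT] | cl <- F.2].

Definition nvars (F : cnf) : nat := F.1.

Definition ETH : Prop :=
  ~ exists (M : TM) (T : nat -> nat),
      subexp T /\ decides_within M T wf_cnf enc_cnf nvars sat.

(* A concept over X = 'I_x is a row (seq bool of length x); c(j) = nth false c j. *)
Definition teaching_set (x : nat) (c : seq bool) (D : seq (seq bool))
    (S : {set 'I_x}) : Prop :=
  forall c', c' \in D -> c' != c ->
    exists2 j : 'I_x, j \in S & nth false c j != nth false c' j.

Definition teaching_plan (x : nat) (C : seq (seq bool))
    (s : seq (seq bool)) (S : nat -> {set 'I_x}) : Prop :=
  perm_eq s C /\
  forall i, i < size s -> teaching_set (nth [::] s i) (drop i s) (S i).

(* RTD(C) <= k  iff some teaching plan has order <= k
   (RTD is the minimum order over teaching plans). *)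
Definition RTD_le (x : nat) (C : seq (seq bool)) (k : nat) : Prop :=
  exists (s : seq (seq bool)) (S : nat -> {set 'I_x}),
    teaching_plan C s S /\ forall i, i < size s -> #|S i| <= k.

(* k-RTD instance: Boolean matrix (rows = concepts, pairwise distinct, all of
   the same length |X|) together with k. *)
Definition rtd_inst := (seq (seq bool) * nat)%type.

Definition ncols (C : seq (seq bool)) : nat := size (head [::] C).

Definition valid_rtd (I : rtd_inst) : Prop :=
  uniq I.1 /\ all (fun r => size r == ncols I.1) I.1.

Definition rtd_yes (I : rtd_inst) : Prop := @RTD_le (ncols I.1) I.1 I.2.

Definition rtd_size (I : rtd_inst) : nat := size I.1 * ncols I.1.

Definition enc_rtd (I : rtd_inst) : seq letter :=
  flatten [seq map bit r ++ [:: LS] | r <- I.1] ++ LT :: nseq I.2 L1.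

(* Main.v *)
(** 3SAT on [N] variables reduces to [k]-RTD with [k] about [sqrt (2 * N)] on a matrix of
    size [2 ^ O(k)], so that [log ^ 2] of the size is [O(N)].

    Split the variables into [k] blocks of [k] variables.  The elements to be covered
    are the clauses together with the tautologies [x \/ ~ x]; the sets are the
    [k * 2 ^ k] assignments of single blocks, each covering the clauses it
    satisfies, and all singletons.  A block assignment covers the tautologies of
    its own block only, so a cover by [k] sets takes one assignment per block, and
    glueing them satisfies the formula.

    The covering problem is planted in the cube [{0,1} ^ k.+1]: to each [z] one
    appends a tail, namely all ones if [z] is nonzero, all zeros if [z = 0] and,
    whenever [z] has weight at least two, also the membership vector of every
    element.  Cube neighbours with equal tails force the corresponding cube
    positions into any teaching set, so every row except the zero row needs
    [k.+1] positions, and the zero row can do with [k] iff a cover of size [k]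
    exists.  Once the zero row is gone the other rows can be removed by
    increasing weight, because some cube positions become superfluous.

    The matrix is written by a program on finitely many stacks, each of them kept on
    one track of the tape of a Turing machine; the machine for [k]-RTD is then run
    on the output track, all other tracks being invisible to it. *)
Require Import Defs.
From HB Require Import structures.
From mathcomp Require Import all_boot.
From mathcomp Require Import zify.
From Stdlib Require Import FunctionalExtensionality.

Set Implicit Arguments.
Unset Strict Implicit.
Unset Printing Implicit Defensive.

(** * A set cover gadget for the recursive teaching dimension *)

(** Only the first concept of a plan is hard to find: it must be taught against the whole class, and
    the gadget leaves the zero row as the only candidate.

    The singletons serve the gadget, not the formula: they give each element a column of its own, so
    that rows over the same cube vertex can be told apart at the cost of one column. The price is
    that a cover might use them. The tautologies prevent this: each of the [k] sets has to take care
    of a whole block, and a block has more than one tautology.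

    The cube dimension and the block length both enter the exponent of the matrix size, while their
    product is the number of variables; equal values give [k * k] variables against an exponent
    [O(k)]. At sizes [2 ^ O(k)] a bound [n ^ o(log n)] is [2 ^ o(k * k)], whatever the constant in
    the exponent, so a polynomial slowdown of the simulation and generous estimates do no harm. *)

Lemma teaching_setP (x : nat) (c : seq bool) D (S : {set 'I_x}) :
  teaching_set c D S ->
  forall c', c' \in D -> c' != c ->
  exists2 j, j \in map val (enum S) & nth false c j != nth false c' j.
Proof.
move=> h c' hc' hn; have [j hj hd] := h c' hc' hn.
by exists (val j) => //; apply/mapP; exists j; rewrite ?mem_enum.
Qed.

(** All that the lower bound needs from a plan: its first teaching set works against the whole
    class. Columns become plain numbers, so that they can be split and shifted freely. *)
Lemma RTD_le_first (x : nat) (C : seq (seq bool)) k :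
  C <> [::] -> RTD_le x C k ->
  exists2 c, c \in C & exists2 T : seq nat, size T <= k &
    forall c', c' \in C -> c' != c ->
    exists2 j, j \in T & nth false c j != nth false c' j.
Proof.
move=> hC [s [S [[hp ht] hk]]].
have hs : 0 < size s.
  by rewrite (perm_size hp); case: C hC {hp}.
exists (nth [::] s 0); first by rewrite -(perm_mem hp) mem_nth.
exists (map val (enum (S 0))); first by rewrite size_map -cardE hk.
move=> c' hc' hn; apply: (teaching_setP (ht 0 hs)) => //.
by rewrite drop0 (perm_mem hp).
Qed.

(** Sorting by [rk] gives the plan. Ties may be sorted either way, so a concept has to be separated
    from all others of equal or larger rank. *)
Lemma RTD_le_rank (x : nat) (C : seq (seq bool)) k (rk : seq bool -> nat) :
  uniq C ->
  (forall c, c \in C -> exists T : seq nat, [/\ size T <= k, all (gtn x) T &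
     forall c', c' \in C -> c' != c -> rk c <= rk c' ->
     exists2 j, j \in T & nth false c j != nth false c' j]) ->
  RTD_le x C k.
Proof.
move=> uC hC.
(* Finite choice: the sets are collected into one function by induction on the list. *)
have [T hT] : exists T : seq bool -> seq nat, forall c, c \in C ->
    [/\ size (T c) <= k, all (gtn x) (T c) &
     forall c', c' \in C -> c' != c -> rk c <= rk c' ->
     exists2 j, j \in T c & nth false c j != nth false c' j].
  move: {2 4}C hC => D; elim: C {uC} => [|a C IH] hC.
    by exists (fun=> [::]).
  have [c hc|T hT] := IH; first by apply: hC; rewrite inE hc orbT.
  have [|Ta hTa] := hC a; first by rewrite inE eqxx.
  exists (fun c => if c == a then Ta else T c) => c; rewrite inE.
  by case: eqP => [->|_] //= hc; apply: hT.
pose le := relpre rk leq; pose s := sort le C.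
have tot : total le by move=> u v; apply: leq_total.
have tr : transitive le by move=> u v w; apply: leq_trans.
have ms c : (c \in s) = (c \in C) by rewrite mem_sort.
exists s, (fun i => [set j : 'I_x | val j \in T (nth [::] s i)]).
have hs i : i < size s -> nth [::] s i \in C by move=> h; rewrite -ms mem_nth.
split; first split; first by rewrite perm_sort.
  move=> i hi c' hc' hn.
  have [_ hx hd] := hT _ (hs i hi).
  have [||j hj hne] := hd c' _ hn.
  - by rewrite -ms (mem_drop hc').
  - have := sort_sorted tot C; rewrite -/s -(cat_take_drop i s) (drop_nth [::] hi).
    have hi' : size (take i s) = i by rewrite size_takel // ltnW.
    rewrite nth_cat hi' ltnn subnn /= => h.
    move: h; rewrite (sorted_pairwise tr) pairwise_cat => /and3P[_ _ /= /andP[/allP ha _]].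
    move: hc'; rewrite (drop_nth [::] hi) inE (negbTE hn) /=.
    exact: ha.
  have hjx : j < x by move/allP: hx => /(_ j hj).
  by exists (Ordinal hjx); rewrite ?inE.
move=> i hi; have [hk _ _] := hT _ (hs i hi).
apply: leq_trans hk; rewrite cardE -(size_map val).
apply: uniq_leq_size; first by rewrite map_inj_uniq ?enum_uniq //; apply: val_inj.
by move=> j /mapP[j' + ->]; rewrite mem_enum inE.
Qed.

(** The head bit runs fastest. This is the order in which a binary counter with its least
    significant digit on top of a stack visits the words. *)
Fixpoint bins (n : nat) : seq (seq bool) :=
  if n is n'.+1 then flatten [seq [:: false :: s; true :: s] | s <- bins n']
  else [:: [::]].

Lemma mem_bins n s : (s \in bins n) = (size s == n).
Proof.
elim: n s => [|n IH] s /=; first by rewrite inE; case: s.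
apply/idP/idP => [/flatten_mapP[t ht]|].
  rewrite !inE => /orP[] /eqP-> /=; by rewrite eqSS -IH.
case: s => // b s; rewrite /= eqSS -IH => h; apply/flatten_mapP; exists s => //.
by rewrite !inE; case: b; rewrite eqxx ?orbT.
Qed.

Lemma size_bins n : size (bins n) = 2 ^ n.
Proof.
elim: n => //= n IH; rewrite size_flatten /shape -map_comp expnS -IH.
by elim: (bins n) => //= s l ->; lia.
Qed.

Lemma uniq_flatten_map (S T : eqType) (f : S -> seq T) (s : seq S) :
  uniq s -> (forall x, x \in s -> uniq (f x)) ->
  (forall x y a, x \in s -> y \in s -> a \in f x -> a \in f y -> x = y) ->
  uniq (flatten (map f s)).
Proof.
elim: s => //= x s IH /andP[hx us] hu hd; rewrite cat_uniq hu ?inE ?eqxx //=.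
rewrite IH //; first 1 last.
- by move=> y hy; apply: hu; rewrite inE hy orbT.
- by move=> y z a hy hz; apply: hd; rewrite inE ?hy ?hz orbT.
rewrite andbT; apply/hasPn => a /flatten_mapP[y hy ha]; apply/negP => ha'.
have e : x = y by apply: hd ha' ha; rewrite inE ?eqxx ?hy ?orbT.
by move: hx; rewrite e hy.
Qed.

Lemma uniq_bins n : uniq (bins n).
Proof.
elim: n => //= n IH; apply: uniq_flatten_map => // s t a _ _.
by rewrite !inE => /orP[] /eqP-> /orP[] /eqP[].
Qed.

Section Gadget.

Variables (k m q : nat) (cov : nat -> nat -> bool).

(** Column layout of all rows: [0] to [k] are the cube, [k.+1] is a flag that tells nonzero constant
    rows from all others, and [k.+2 + x] belongs to the set [x]. *)
Definition const_row (z : seq bool) : seq bool := z ++ nseq q.+1 (has id z).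

Definition elem_row (u : nat) (z : seq bool) : seq bool :=
  z ++ false :: mkseq (fun x => cov x u) q.

Definition gadget_rows (z : seq bool) : seq (seq bool) :=
  const_row z ::
    (if 2 <= count id z then [seq elem_row u z | u <- iota 0 m] else [::]).

Definition gadget : seq (seq bool) := flatten [seq gadget_rows z | z <- bins k.+1].

Lemma gadget_cases r : r \in gadget ->
  exists z, [/\ size z = k.+1, r \in gadget_rows z &
    r = const_row z \/ exists u, [/\ 1 < count id z, u < m & r = elem_row u z]].
Proof.
case/flatten_mapP => z; rewrite mem_bins => /eqP hz hr; exists z; split=> //.
move: hr; rewrite inE => /orP[/eqP->|]; first by left.
case: ifP => // hc /mapP[u]; rewrite mem_iota => hu ->.
by right; exists u.
Qed.

Lemma const_row_in z : size z = k.+1 -> const_row z \in gadget.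
Proof.
move=> hz; apply/flatten_mapP; exists z; first by rewrite mem_bins hz.
by rewrite inE eqxx.
Qed.

Lemma elem_row_in u z : size z = k.+1 -> 1 < count id z -> u < m ->
  elem_row u z \in gadget.
Proof.
move=> hz hc hu; apply/flatten_mapP; exists z; first by rewrite mem_bins hz.
rewrite inE hc; apply/orP; right; apply/mapP; exists u => //.
by rewrite mem_iota.
Qed.

Lemma nth_const_row z j : size z = k.+1 -> nth false (const_row z) j =
  if j < k.+1 then nth false z j else (j <= k.+1 + q) && has id z.
Proof.
move=> hz; rewrite nth_cat hz; case: ifP => // h; rewrite nth_nseq.
have -> : (j - k.+1 < q.+1) = (j <= k.+1 + q) by lia.
by case: ifP.
Qed.

Lemma nth_elem_row u z j : size z = k.+1 -> nth false (elem_row u z) j =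
  if j < k.+1 then nth false z j
  else [&& k.+1 < j, j < k.+2 + q & cov (j - k.+2) u].
Proof.
move=> hz; rewrite nth_cat hz; case: ifP => // h.
case e: (j - k.+1) => [|p] /=.
  by have -> : (k.+1 < j) = false by lia.
have -> : k.+1 < j by lia.
have -> : j - k.+2 = p by lia.
have [hp|hp] := ltnP p q; first by rewrite nth_mkseq //; lia.
by rewrite nth_default ?size_mkseq //; lia.
Qed.

Definition flip (z : seq bool) i := set_nth false z i (~~ nth false z i).

Lemma size_flip z i : size z = k.+1 -> i < k.+1 -> size (flip z i) = k.+1.
Proof. by move=> hz hi; rewrite size_set_nth hz; lia. Qed.

Lemma nth_flip z i j : nth false (flip z i) j =
  if j == i then ~~ nth false z i else nth false z j.
Proof. by rewrite nth_set_nth. Qed.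

Lemma has_nth z a : nth false z a -> has id z.
Proof.
move=> h; apply/(has_nthP false); exists a => //.
by rewrite ltnNge; apply/negP => h'; move: h; rewrite nth_default.
Qed.

Lemma count_nth2 z a b : a != b -> nth false z a -> nth false z b -> 1 < count id z.
Proof.
elim: z a b => [|c z IH] [|a] [|b] //=.
- by move=> _ -> /has_nth; rewrite has_count; lia.
- by move=> _ /has_nth + ->; rewrite has_count; lia.
- by rewrite eqSS => h ha hb; have := IH _ _ h ha hb; lia.
Qed.

Lemma has_exists_nth z : has id z -> exists2 a, a < size z & nth false z a.
Proof. by case/(has_nthP false) => a h1 h2; exists a. Qed.

Lemma count_exists2 z : 1 < count id z ->
  exists a b, [/\ a != b, a < size z, b < size z, nth false z a & nth false z b].
Proof.
elim: z => //= c z IH; case: c => /=.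
  rewrite add1n ltnS -has_count => /has_exists_nth[a h1 h2].
  by exists 0, a.+1.
rewrite add0n => /IH[a [b [h1 h2 h3 h4 h5]]]; exists a.+1, b.+1; by rewrite eqSS.
Qed.

Hypothesis m_gt2 : 2 < m.
Hypothesis cov_single : forall u, u < m -> exists2 x, x < q &
  forall u', u' < m -> cov x u' = (u' == u).
(** If [x] missed [u] only, its column alone would separate [elem_row u z] from every other row over
    [z], and the count in [elem_row_hard] would be one short. *)
Hypothesis cov_miss : forall x u, x < q -> u < m -> ~~ cov x u ->
  exists u', [/\ u' < m, u' != u & ~~ cov x u'].

Definition is_cover (P : seq nat) :=
  [/\ size P <= k, all (gtn q) P & forall u, u < m -> has (fun x => cov x u) P].

Lemma not_too_many (T s : seq nat) : size T <= k -> uniq s -> {subset s <= T} ->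
  size s <= k.
Proof. by move=> hT us hs; apply: leq_trans hT; apply: uniq_leq_size. Qed.

Lemma has_flip z i a : nth false z a -> i != a -> has id (flip z i).
Proof. by move=> ha hi; apply: (@has_nth _ a); rewrite nth_flip eq_sym (negbTE hi). Qed.

(** * Lower bound: only the zero row can be taught first *)

Definition teaches (T : seq nat) (c : seq bool) := forall c', c' \in gadget -> c' != c ->
    exists2 j, j \in T & nth false c j != nth false c' j.

Definition outside (l : seq nat) : seq nat := [seq i <- iota 0 k.+1 | i \notin l].

Lemma mem_outside l i : (i \in outside l) = (i \notin l) && (i < k.+1).
Proof. by rewrite mem_filter mem_iota. Qed.

Lemma uniq_outside l : uniq (outside l).
Proof. by rewrite filter_uniq ?iota_uniq. Qed.

Lemma size_outside l : uniq l -> all (gtn k.+1) l -> size (outside l) + size l = k.+1.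
Proof.
move=> ul /allP hl; rewrite -[RHS](size_iota 0) -(count_predC (mem l) (iota 0 k.+1)) addnC.
rewrite /outside size_filter; apply/eqP; rewrite eqn_add2r; apply/eqP; rewrite -size_filter.
apply/perm_size/uniq_perm; rewrite ?filter_uniq ?iota_uniq // => i.
rewrite mem_filter mem_iota add0n leq0n /=; case: (boolP (i \in l)) => //= /hl.
by move=> /= ->.
Qed.

Lemma size_outside1 a : a < k.+1 -> size (outside [:: a]) = k.
Proof.
by move=> ha; apply/eqP; rewrite -eqSS -addn1 (@size_outside [:: a]) //= andbT.
Qed.

Lemma size_outside2 a b : a != b -> a < k.+1 -> b < k.+1 ->
  (size (outside [:: a; b])).+1 = k.
Proof.
move=> hab ha hb; apply/eqP; rewrite -eqSS -addn2 (@size_outside [:: a; b]) //=.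
  by rewrite inE hab.
by rewrite andbT; apply/andP.
Qed.

(** A neighbour with the same tail differs in the flipped position only, so every position whose
    flip is nonzero is forced. If [z] has a single one, its flip is the zero row, which tail columns
    separate too; but the [k] other positions are forced already, and this takes one more column of
    whichever kind. *)
Lemma const_row_hard z T : size z = k.+1 -> has id z -> size T <= k ->
  ~ teaches T (const_row z).
Proof.
move=> hz hhz hT ht; have [a ha hza] := has_exists_nth hhz; rewrite hz in ha.
have forced i : i < k.+1 -> has id (flip z i) -> i \in T.
  move=> hi hf; have hsf := size_flip hz hi.
  have [|j hj] := ht _ (const_row_in hsf).
    apply/eqP => /(congr1 (fun s => nth false s i)).
    rewrite !nth_const_row // hi nth_flip eqxx; by case: nth.
  rewrite !nth_const_row // hhz hf nth_flip; case: ifP => [_|]; last by rewrite eqxx.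
  by case: (eqVneq j i) => [<- //|_]; rewrite eqxx.
have [x hx hxz] : exists2 x, x \in T & x \notin outside [:: a].
  have [hf|hf] := boolP (has id (flip z a)).
    by exists a; [exact: forced | rewrite mem_outside inE eqxx].
  have [|j hj] := ht _ (const_row_in (size_flip hz ha)).
    apply/eqP => /(congr1 (fun s => nth false s a)).
    rewrite !nth_const_row ?size_flip // ha nth_flip eqxx; by case: nth.
  move=> hd; exists j => //; apply/negP; rewrite mem_outside inE => /andP[h1 h2].
  move: hd; rewrite !nth_const_row ?size_flip // (_ : j < k.+1 = true) // nth_flip.
  by rewrite (negbTE h1) eqxx.
have := @not_too_many T (x :: outside [:: a]) hT.
rewrite cons_uniq hxz uniq_outside => /(_ isT) H.
suff: k < k by rewrite ltnn.
rewrite -{1}(size_outside1 ha).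
apply: H => i; rewrite inE => /orP[/eqP->//|]; rewrite mem_outside inE.
by move=> /andP[h1 h2]; apply: forced => //; apply: has_flip hza h1.
Qed.

(** Flips away from two ones [a] and [b] keep the weight at least two and force [k - 1] cube
    positions. The tail then needs two columns: [x], with entry 0, against [const_row z]; and, since
    some other element also has entry 0 there, a different [y] against that element. *)
Lemma elem_row_hard z u T : size z = k.+1 -> 1 < count id z -> u < m -> size T <= k ->
  ~ teaches T (elem_row u z).
Proof.
move=> hz hcz hu hT ht; have [a [b [hab ha hb hza hzb]]] := count_exists2 hcz.
rewrite hz in ha hb; set l := outside [:: a; b].
have forced i : i \in l -> i \in T.
  rewrite mem_outside !inE negb_or => /andP[/andP[hia hib] hi].
  have hc : 1 < count id (flip z i).
    by apply: count_nth2 hab _ _; rewrite nth_flip eq_sym ?(negbTE hia) ?(negbTE hib).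
  have [|j hj] := ht _ (elem_row_in (size_flip hz hi) hc hu).
    apply/eqP => /(congr1 (fun s => nth false s i)).
    rewrite !nth_elem_row ?size_flip // hi nth_flip eqxx; by case: nth.
  rewrite !nth_elem_row ?size_flip // nth_flip; case: ifP => _; last by rewrite eqxx.
  by case: (eqVneq j i) => [<- //|_]; rewrite eqxx.
have lo i : i \in l -> i < k.+1 by rewrite mem_outside => /andP[_].
have hhz := has_nth hza.
have [x hx [hxk hxq hxu]] : exists2 x, x \in T &
    [/\ k < x, x < k.+2 + q & ~~ ((k.+1 < x) && cov (x - k.+2) u)].
  have [|j hj] := ht _ (const_row_in hz).
    apply/eqP => /(congr1 (fun s => nth false s k.+1)).
    by rewrite nth_const_row // nth_elem_row // !ltnn hhz leq_addr.
  rewrite nth_const_row // nth_elem_row // hhz; case: ltnP => hjk; rewrite ?eqxx // => hd.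
  exists j => //; move: hd; have [hq|hq] := ltnP j (k.+2 + q); last first.
    by rewrite /= !andbF (_ : j <= k.+1 + q = false) //; lia.
  rewrite (_ : j <= k.+1 + q) /=; last by lia.
  by split => //; apply: contraNN hd => ->.
have [u' [hu' huu' hxu']] : exists u', [/\ u' < m, u' != u & ~~ ((k.+1 < x) && cov (x - k.+2) u')].
  (* In the flag column all element rows have entry 0, so any element other than [u] will do;
     [u == 0] read as a number is one. *)
  have [hx'|hx'] := ltnP k.+1 x; last first.
    by exists (u == 0 : nat); split=> //; case: eqP; lia.
  by rewrite hx' /= in hxu; apply: cov_miss hxu => //; lia.
have [y hy [hyk hyx]] : exists2 y, y \in T & k < y /\ y != x.
  have [|j hj] := ht _ (elem_row_in hz hcz hu').
    have [s hs hsu] := cov_single hu.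
    apply/eqP => /(congr1 (fun r => nth false r (k.+2 + s))).
    rewrite !nth_elem_row // addKn ltn_add2l hs !hsu // eqxx (negbTE huu').
    by case: ltnP; [lia | rewrite ltnS leq_addr].
  rewrite !nth_elem_row //; case: ltnP => hjk; rewrite ?eqxx // => hd.
  exists j => //; split=> //; apply: contraNneq hd => ->.
  by rewrite hxq /= (negbTE hxu) (negbTE hxu').
have := @not_too_many T [:: x, y & l] hT.
have -> : size [:: x, y & l] = k.+1.
  by rewrite -[in RHS](size_outside2 hab ha hb).
rewrite ltnn !cons_uniq !inE negb_or eq_sym hyx uniq_outside !andbT.
have -> : x \notin l by apply/negP => /lo; lia.
have -> : y \notin l by apply/negP => /lo; lia.
move=> H; suff: false by []; apply: H => // i; rewrite !inE.
by case/or3P=> [/eqP->|/eqP->|/forced].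
Qed.

Lemma exists_notin (s T : seq nat) : uniq s -> size T < size s ->
  exists2 a, a \in s & a \notin T.
Proof.
move=> us h; apply/allPn; apply: contraTN h => /allP hs; rewrite -leqNgt.
exact: uniq_leq_size.
Qed.

Lemma cover_of_teaching T : size T <= k -> teaches T (const_row (nseq k.+1 false)) ->
  exists P, is_cover P.
Proof.
move=> hT ht; set z0 := nseq k.+1 false in ht.
have hz0 : size z0 = k.+1 by rewrite size_nseq.
have z0F : has id z0 = false by rewrite /z0 has_nseq.
have nz0 j : nth false z0 j = false by rewrite nth_nseq; case: ifP.
pose TZ := [seq j <- T | j < k.+1]; pose TN := [seq j <- T | ~~ (j < k.+1)].
have hs : size TZ + size TN = size T by rewrite !size_filter count_predC.
have [a ha haT] : exists2 a, a \in iota 0 k.+1 & a \notin TZ.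
  by apply: exists_notin; rewrite ?iota_uniq // size_iota; lia.
rewrite mem_iota add0n in ha.
have haT' : a \notin T by move: haT; rewrite mem_filter (_ : a < k.+1).
have [hk|hk] := leqP k (size TZ).
  have hsz : size (flip z0 a) = k.+1 by rewrite size_flip.
  have [|j hj] := ht _ (const_row_in hsz).
    apply/eqP => /(congr1 (fun s => nth false s a)).
    by rewrite !nth_const_row // (_ : a < k.+1 = true) // nth_flip eqxx nz0.
  rewrite !nth_const_row // z0F andbF nth_flip !nz0; case: (eqVneq j a) => [e|_].
    by move: haT'; rewrite -e hj.
  case: ifP => // hjk; have: j \in TN by rewrite mem_filter hjk.
  by have -> : TN = [::] by apply: size0nil; lia.
have [b hb hbT] : exists2 b, b \in iota 0 k.+1 & b \notin a :: TZ.
  by apply: exists_notin; rewrite ?iota_uniq // size_iota.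
rewrite mem_iota add0n in hb; rewrite inE negb_or in hbT; case/andP: hbT => hba hbT.
have hbT' : b \notin T by move: hbT; rewrite mem_filter (_ : b < k.+1).
pose z := flip (flip z0 a) b.
have hz : size z = k.+1 by rewrite !size_flip.
have nz j : nth false z j = (j == a) || (j == b).
  by rewrite !nth_flip !nz0 (negbTE hba); case: (j == b); case: (j == a).
have hcz : 1 < count id z.
  by apply: (@count_nth2 _ a b); rewrite ?nz ?eqxx ?orbT // eq_sym.
exists [seq j - k.+2 | j <- T & (k.+1 < j < k.+2 + q)]; split.
- by rewrite size_map size_filter (leq_trans (count_size _ _)).
- apply/allP => _ /mapP[j + ->]; rewrite mem_filter => /andP[h _] /=; lia.
move=> u hu; have [|j hj] := ht _ (elem_row_in hz hcz hu).
  apply/eqP => /(congr1 (fun s => nth false s a)).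
  by rewrite nth_const_row // nth_elem_row // (_ : a < k.+1 = true) // nz nz0 eqxx.
rewrite nth_const_row // nth_elem_row // z0F andbF nz nz0.
case: ifP => [_|_].
  case: (eqVneq j a) => [e|_]; first by move: haT'; rewrite -e hj.
  by case: (eqVneq j b) => [e|_] //; move: hbT'; rewrite -e hj.
rewrite eq_sym eqbF_neg negbK => /and3P[h1 h2 h3].
apply/hasP; exists (j - k.+2) => //; apply: map_f; by rewrite mem_filter h1 h2.
Qed.

Lemma gadget_neq0 : gadget <> [::].
Proof.
move=> h; have := @const_row_in (nseq k.+1 false) (size_nseq _ _).
by rewrite h.
Qed.

Lemma RTD_gadget_cover x : RTD_le x gadget k -> exists P, is_cover P.
Proof.
move=> h; have [c hc [T hT ht]] := RTD_le_first gadget_neq0 h.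
have [z [hz _ [e|[u [h1 h2 e]]]]] := gadget_cases hc; subst c; last first.
  by case: (elem_row_hard hz h1 h2 hT ht).
have [hh|hh] := boolP (has id z); first by case: (const_row_hard hz hh hT ht).
apply: (@cover_of_teaching T) => //; suff <- : z = nseq k.+1 false by [].
apply: (@eq_from_nth _ false) => [|i _]; rewrite ?size_nseq // nth_nseq if_same.
by apply/negbTE; apply: contraNN hh => /has_nth.
Qed.

(** * Distinctness of the rows, and a teaching plan from a cover *)

Lemma uniq_gadget : uniq gadget.
Proof.
apply: uniq_flatten_map; first exact: uniq_bins.
  move=> z; rewrite mem_bins => /eqP hz; rewrite /gadget_rows /=; case: ifP => //= hc.
  apply/andP; split.
    apply/mapP => -[u _ /(congr1 (fun s => nth false s k.+1))].
    rewrite nth_const_row // nth_elem_row // !ltnn leq_addr /= has_count.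
    by rewrite (ltn_trans _ hc).
  rewrite map_inj_in_uniq ?iota_uniq // => u v; rewrite !mem_iota add0n => hu hv e.
  have [x hx hxu] := cov_single hu.
  move/(congr1 (fun s => nth false s (k.+2 + x))): e; rewrite !nth_elem_row //.
  rewrite addKn !hxu // eqxx ltn_add2l hx; case: ltnP; first by lia.
  by rewrite ltnS leq_addr /= => _ /esym/eqP ->.
move=> z z' r; rewrite !mem_bins => /eqP hz /eqP hz' hr hr'.
have tk y : size y = k.+1 -> r \in gadget_rows y -> y = take k.+1 r.
  move=> hy; rewrite inE => /orP[/eqP->|]; first by rewrite -hy take_size_cat.
  by case: ifP => // _ /mapP[u _ ->]; rewrite -hy take_size_cat.
by rewrite (tk z) // -(tk z').
Qed.

Lemma size_gadget_row r : r \in gadget -> size r = k.+2 + q.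
Proof.
case/gadget_cases => z [hz _ [->|[u [_ _ ->]]]]; rewrite size_cat hz /=.
  by rewrite size_nseq addnS.
by rewrite size_mkseq addnS.
Qed.

Lemma size_gadget : size gadget <= 2 ^ k.+1 * m.+1.
Proof.
rewrite size_flatten /shape -map_comp -size_bins.
elim: (bins k.+1) => //= z l IH; rewrite mulSn leq_add //.
by case: ifP; rewrite ?size_map ?size_iota.
Qed.

(** The zero row has rank 1, a constant row of weight [w > 0] has rank [2 * w], an element row
    [2 * w + 1]. Constant rows go before element rows of the same weight because the singleton
    column of [u] does not separate [elem_row u z] from [const_row z]. *)
Definition rank (r : seq bool) : nat :=
  2 * count id (take k.+1 r) + ~~ nth false r k.+1.

Lemma rank_const z : size z = k.+1 -> rank (const_row z) = 2 * count id z + ~~ has id z.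
Proof.
move=> hz; rewrite /rank nth_const_row // ltnn leq_addr.
by rewrite -{1}hz take_size_cat.
Qed.

Lemma rank_elem u z : size z = k.+1 -> rank (elem_row u z) = (2 * count id z).+1.
Proof.
move=> hz; rewrite /rank nth_elem_row // !ltnn.
by rewrite -{1}hz take_size_cat // addn1.
Qed.

Lemma count_le_of_sub z z' : size z = size z' ->
  (forall j, nth false z' j -> nth false z j) -> count id z' <= count id z.
Proof.
elim: z z' => [|c z IH] [|c' z'] //= [hs] H; apply: leq_add.
  by have /= := H 0; case: (c); case: (c') => // /(_ isT).
by apply: IH => // j; apply: (H j.+1).
Qed.

Lemma eq_of_sub_count z z' : size z = size z' ->
  (forall j, nth false z' j -> nth false z j) -> count id z <= count id z' -> z = z'.
Proof.
elim: z z' => [|c z IH] [|c' z'] //= [hs] H hc.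
have Hz j : nth false z' j -> nth false z j by apply: (H j.+1).
have := count_le_of_sub hs Hz; have /= := H 0; move: hc {H}.
case: c; case: c' => /= hc h0 hle; try by have := h0 isT.
- by congr cons; apply: IH; rewrite // -(leq_add2l 1).
- by lia.
- by congr cons; apply: IH.
Qed.

Lemma outside_eq z z' l : size z = k.+1 -> size z' = k.+1 ->
  (forall a, a \in l -> nth false z a) ->
  (forall j, j \in outside l -> nth false z j = nth false z' j) ->
  count id z <= count id z' -> z = z'.
Proof.
move=> hz hz' hl H hc; apply: eq_of_sub_count hc; first by rewrite hz hz'.
move=> j hj; have [/hl //|hjl] := boolP (j \in l).
rewrite H // mem_outside hjl -hz' ltnNge; apply/negP => h.
by move: hj; rewrite nth_default.
Qed.

Lemma teaches_of_agree (T : seq nat) (c c' : seq bool) : c' != c ->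
  ((forall j, j \in T -> nth false c j = nth false c' j) -> c = c') ->
  exists2 j, j \in T & nth false c j != nth false c' j.
Proof.
move=> hne h; apply/hasP; apply: contraNT hne => /hasPn hT.
by rewrite h // => j /hT; rewrite negbK => /eqP.
Qed.

(** Teaching sets with at most [k] columns: the cover for the zero row; all cube positions but the
    one for weight one; for larger weight all cube positions but two ones, together with the flag
    for a constant row or the singleton column of [u] for an element row. *)
Lemma cover_RTD_gadget P : is_cover P -> RTD_le (k.+2 + q) gadget k.
Proof.
case=> hPk hPq hP; apply: (@RTD_le_rank _ _ _ rank); first exact: uniq_gadget.
have nthE z j : size z = k.+1 -> j < k.+1 -> forall r, r \in gadget_rows z ->
    nth false r j = nth false z j.
  move=> hz hj r; rewrite inE => /orP[/eqP->|]; first by rewrite nth_const_row // hj.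
  by case: ifP => // _ /mapP[u _ ->]; rewrite nth_elem_row // hj.
have rank_ge z r : size z = k.+1 -> r \in gadget_rows z ->
    rank r <= (2 * count id z).+1 /\ (has id z -> 2 * count id z <= rank r).
  move=> hz; rewrite inE => /orP[/eqP->|].
    by rewrite rank_const //; case: has; lia.
  by case: ifP => // _ /mapP[u _ ->]; rewrite rank_elem //; lia.
have allout T l : all (gtn (k.+2 + q)) T -> all (gtn (k.+2 + q)) (outside l ++ T).
  move=> hT; rewrite all_cat hT andbT; apply/allP => i; rewrite mem_outside.
  by move=> /andP[_] /=; lia.
move=> c /gadget_cases [z [hz hcz [e|[u [hc hu e]]]]]; subst c.
- have [hh|hh] := boolP (has id z); last first.
    exists [seq k.+2 + x | x <- P]; split; first by rewrite size_map.
      by apply/allP => _ /mapP[x /(allP hPq) /= hx ->]; lia.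
    move=> c' /gadget_cases [z' [hz' hcz' [e|[u [hc hu e]]]]] hne _; subst c'.
      have hh' : has id z'.
        apply: contraNT hne => hh'; rewrite /const_row (negbTE hh) (negbTE hh').
        have E y : size y = k.+1 -> ~~ has id y -> y = nseq k.+1 false.
          move=> hy hn; apply: (@eq_from_nth _ false) => [|i _]; rewrite ?size_nseq //.
          rewrite nth_nseq if_same; by apply/negbTE; apply: contraNN hn => /has_nth.
        by rewrite (E z) // (E z').
      (* The cover is nonempty because element 0 exists, and any set column separates the zero row
         from a nonzero constant row. *)
      have /hasP[x hx _] := hP 0 (ltn_trans (isT : 0 < 2) m_gt2).
      exists (k.+2 + x); first exact: map_f.
      rewrite !nth_const_row // (negbTE hh) hh' andbF.
      have -> : (k.+2 + x < k.+1) = false by lia.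
      by have /= := allP hPq x hx; rewrite andbT; lia.
    have /hasP[x hx hxu] := hP u hu.
    exists (k.+2 + x); first exact: map_f.
    rewrite nth_const_row // nth_elem_row // (negbTE hh) andbF addKn hxu.
    have -> : (k.+2 + x < k.+1) = false by lia.
    by have /= := allP hPq x hx; rewrite andbT; lia.
  have [hc|hc] := leqP 2 (count id z); last first.
    have [a ha hza] := has_exists_nth hh; rewrite hz in ha.
    exists (outside [:: a]); split.
    + by rewrite size_outside1.
    + by have := @allout [::] [:: a]; rewrite cats0; apply.
    move=> c' /gadget_cases [z' [hz' hcz' hc']] hne hrk.
    apply: (teaches_of_agree hne) => hT.
    have ez : z = z'.
      apply: (@outside_eq _ _ [:: a]) => //; first by move=> b; rewrite inE => /eqP->.
        move=> j hj; have E := hT j hj; move: hj; rewrite mem_outside => /andP[_ hj].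
        by rewrite (nthE _ _ hz hj _ hcz) (nthE _ _ hz' hj _ hcz') in E.
      have [_ h2] := rank_ge z _ hz hcz; have [h3 _] := rank_ge z' _ hz' hcz'.
      by have := h2 hh; lia.
    subst z'; case: hc' => [-> //|[u [h _ _]]]; lia.
  have [a [b [hab ha hb hza hzb]]] := count_exists2 hc; rewrite hz in ha hb.
  exists (rcons (outside [:: a; b]) k.+1); split.
  + by rewrite size_rcons size_outside2.
  + by rewrite -cats1 allout //= andbT; lia.
  move=> c' /gadget_cases [z' [hz' hcz' hc']] hne hrk.
  apply: (teaches_of_agree hne) => hT.
  have ez : z = z'.
    apply: (@outside_eq _ _ [:: a; b]) => //.
    * by move=> i; rewrite !inE => /orP[] /eqP->.
    * move=> j hj; have := hT j; rewrite mem_rcons inE hj orbT => /(_ isT) E.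
      move: hj; rewrite mem_outside => /andP[_ hj].
      by rewrite (nthE _ _ hz hj _ hcz) (nthE _ _ hz' hj _ hcz') in E.
    have [_ h2] := rank_ge z _ hz hcz; have [h3 _] := rank_ge z' _ hz' hcz'.
    by have := h2 hh; lia.
  subst z'; case: hc' => [-> //|[u [_ _ e]]]; subst c'.
  have := hT k.+1; rewrite mem_rcons inE eqxx => /(_ isT).
  by rewrite nth_const_row // nth_elem_row // !ltnn hh leq_addr.
have [a [b [hab ha hb hza hzb]]] := count_exists2 hc; rewrite hz in ha hb.
have [s hs hsu] := cov_single hu.
exists (rcons (outside [:: a; b]) (k.+2 + s)); split.
+ by rewrite size_rcons size_outside2.
+ by rewrite -cats1 allout //= andbT; lia.
move=> c' /gadget_cases [z' [hz' hcz' hc']] hne hrk.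
apply: (teaches_of_agree hne) => hT.
rewrite rank_elem // in hrk.
have ez : z = z'.
  apply: (@outside_eq _ _ [:: a; b]) => //.
  * by move=> i; rewrite !inE => /orP[] /eqP->.
  * move=> j hj; have := hT j; rewrite mem_rcons inE hj orbT => /(_ isT) E.
    move: (hj); rewrite mem_outside => /andP[_ hj'].
    by rewrite (nthE _ _ hz hj' _ hcz) (nthE _ _ hz' hj' _ hcz') in E.
  by have [h3 _] := rank_ge z' _ hz' hcz'; lia.
subst z'; case: hc' => [e|[u' [_ hu' e]]]; subst c'.
  by move: hrk; rewrite rank_const // (has_nth hza) addn0; lia.
have := hT (k.+2 + s); rewrite mem_rcons inE eqxx => /(_ isT).
rewrite !nth_elem_row // addKn ltn_add2l hs !hsu // eqxx.
case: ltnP; first by lia.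
by rewrite ltnS leq_addr /= => _ /esym/eqP ->.
Qed.

Lemma RTD_gadget : RTD_le (k.+2 + q) gadget k <-> exists P, is_cover P.
Proof. by split=> [|[P]]; [exact: RTD_gadget_cover | exact: cover_RTD_gadget]. Qed.

End Gadget.

(** * Satisfiability as a covering problem *)

(* A partial assignment lists values of variables; [None] and the positions
   beyond its end are undefined. *)
Definition clause_true (w : seq (option bool)) (cl : seq (bool * nat)) : bool :=
  has (fun l => nth None w l.2 == Some l.1) cl.

Definition taut (x : nat) : seq (bool * nat) := [:: (true, x); (false, x)].

Section CoverOfCnf.

Variables (k : nat) (F : seq (seq (bool * nat))).

(* A partial assignment satisfies [taut x] iff it defines [x]. *)
Definition ext_clauses : seq (seq (bool * nat)) :=
  [seq taut x | x <- rev (iota 0 (k * k))] ++ F.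

Definition block (i : nat) (al : seq bool) : seq (option bool) :=
  nseq (i * k) None ++ map Some al.

Definition block_asgs : seq (seq (option bool)) :=
  flatten [seq [seq block i al | al <- bins k] | i <- iota 0 k].

Local Notation m := (size ext_clauses).
Local Notation q := (m + size block_asgs).

Definition clause_cov (x u : nat) : bool :=
  if x < m then x == u
  else clause_true (nth [::] block_asgs (x - m)) (nth [::] ext_clauses u).

Hypothesis k_gt1 : 1 < k.
Hypothesis F_vars : all (all (fun l => l.2 < k * k)) F.

Lemma taut_true w x : clause_true w (taut x) = (nth None w x != None).
Proof. by rewrite /clause_true /=; case: nth => [[]|]. Qed.

Lemma nth_block i al x : size al = k ->
  nth None (block i al) x =
  if (i * k <= x) && (x < i.+1 * k) then Some (nth false al (x - i * k)) else None.
Proof.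
move=> hs; rewrite nth_cat size_nseq mulSn.
case: ltnP => hx; first by rewrite nth_nseq if_same.
have [h|h] := ltnP x; first by rewrite (nth_map false) //; lia.
by rewrite nth_default // size_map hs; lia.
Qed.

Lemma block_defined i al x : size al = k ->
  (nth None (block i al) x != None) = (x %/ k == i).
Proof.
move=> hs; rewrite nth_block //.
have k0 : 0 < k by lia.
have -> : (i * k <= x) && (x < i.+1 * k) = (x %/ k == i).
  by rewrite -leq_divRL // -ltn_divLR // ltnS eqn_leq andbC.
by case: (_ == i).
Qed.

Lemma mem_block_asgs w : w \in block_asgs ->
  exists i al, [/\ i < k, size al = k & w = block i al].
Proof.
case/flatten_mapP => i; rewrite mem_iota => hi /mapP[al].
by rewrite mem_bins => /eqP hal ->; exists i, al.
Qed.

Lemma block_in i al : i < k -> size al = k -> block i al \in block_asgs.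
Proof.
move=> hi hs; apply/flatten_mapP; exists i; first by rewrite mem_iota.
by apply/mapP; exists al; rewrite ?mem_bins ?hs.
Qed.

(** The tautologies are listed by decreasing variable, the order in which successive pushes leave
    them on a stack. *)
Definition taut_idx (x : nat) := (k * k - x.+1).

Lemma taut_idx_lt x : x < k * k -> taut_idx x < m.
Proof. by rewrite size_cat size_map size_rev size_iota /taut_idx; lia. Qed.

Lemma nth_taut x : x < k * k -> nth [::] ext_clauses (taut_idx x) = taut x.
Proof.
move=> hx; rewrite nth_cat size_map size_rev size_iota /taut_idx.
rewrite ifT; last by lia.
rewrite (nth_map 0) ?size_rev ?size_iota; last by lia.
rewrite nth_rev ?size_iota; last by lia.
by rewrite nth_iota; [congr taut; lia | lia].
Qed.

Lemma taut_idx_inj x y : x < k * k -> y < k * k -> taut_idx x = taut_idx y -> x = y.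
Proof. rewrite /taut_idx; lia. Qed.

Lemma m_large : 2 < m.
Proof. by rewrite size_cat size_map size_rev size_iota; nia. Qed.

Lemma clause_cov_single u : u < m -> exists2 x, x < q &
  forall u', u' < m -> clause_cov x u' = (u' == u).
Proof.
move=> hu; exists u; first by lia.
by move=> u' _; rewrite /clause_cov hu eq_sym.
Qed.

Lemma cov_asg x : m <= x < q -> exists i al,
  [/\ i < k, size al = k, nth [::] block_asgs (x - m) = block i al &
      forall y, y < k * k -> clause_cov x (taut_idx y) = (y %/ k == i)].
Proof.
move=> hx; have [|i [al [hi hal e]]] := @mem_block_asgs (nth [::] block_asgs (x - m)).
  by case/andP: hx => h1 h2; rewrite mem_nth // ltn_subLR.
exists i, al; split=> // y hy.
rewrite /clause_cov ifF; last by case/andP: hx => h1 _; rewrite ltnNge h1.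
by rewrite nth_taut // e taut_true block_defined.
Qed.

(** A singleton misses every element but one, and there are at least three. A block assignment
    misses all tautologies of another block; [k > 1] provides such a block and two tautologies in
    it, one of which is not [u]. *)
Lemma clause_cov_miss x u : x < q -> u < m -> ~~ clause_cov x u ->
  exists u', [/\ u' < m, u' != u & ~~ clause_cov x u'].
Proof.
move=> hx hu hxu; have hm := m_large; have [h|h] := ltnP x m.
  have [u' [h1 h2 h3]] : exists u', [/\ u' < m, u' != u & x != u'].
    case: (eqVneq 0 u) => [|h0]; case: (eqVneq 0 x) => [|h0'].
    - by move=> <- <-; exists 1; split=> //; lia.
    - move=> e; have [h1|h1] := eqVneq x 1; [exists 2 | exists 1]; split=> //; lia.
    - move=> e; have [h1|h1] := eqVneq u 1; [exists 2 | exists 1]; split=> //; lia.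
    - by exists 0; split=> //; [lia | rewrite eq_sym].
  by exists u'; rewrite /clause_cov h.
have [|i [al [hi _ _ hc]]] := @cov_asg x; first by lia.
pose i' := (i == 0 : nat).
have hi' : i' < k /\ i' != i by rewrite /i'; case: eqP; lia.
have key d : d < k -> i' * k + d < k * k /\ ~~ clause_cov x (taut_idx (i' * k + d)).
  move=> hd; have hlt : i' * k + d < k * k by case: hi' => h1 _; nia.
  by rewrite hc // divnMDl ?divn_small ?addn0 //; [case: hi' | lia].
have [h0 c0] := key 0 (ltnW k_gt1); have [h1 c1] := key 1 k_gt1.
have [e|e] := eqVneq (taut_idx (i' * k + 0)) u.
  exists (taut_idx (i' * k + 1)); split; rewrite ?taut_idx_lt //.
  by apply/eqP => e'; have := taut_idx_inj h0 h1; rewrite e e' => /(_ erefl); lia.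
by exists (taut_idx (i' * k + 0)); split; rewrite ?taut_idx_lt.
Qed.

Lemma ext_nth u : u < m ->
  (exists2 x, x < k * k & nth [::] ext_clauses u = taut x) \/
  nth [::] ext_clauses u \in F.
Proof.
move=> hu; have : nth [::] ext_clauses u \in ext_clauses by apply: mem_nth.
rewrite mem_cat => /orP[/mapP[x]|]; last by right.
by rewrite mem_rev mem_iota => hx ->; left; exists x.
Qed.

Lemma ext_index cl : cl \in F -> exists2 u, u < m & nth [::] ext_clauses u = cl.
Proof.
move=> h; have h' : cl \in ext_clauses by rewrite mem_cat h orbT.
by exists (index cl ext_clauses); rewrite ?index_mem ?nth_index.
Qed.

Lemma cover_of_sat : (exists a : nat -> bool, all (has (fun l => a l.2 == l.1)) F) ->
  exists P, is_cover k m q clause_cov P.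
Proof.
case=> a /allP ha; have k0 : 0 < k by lia.
pose al i := mkseq (fun j => a (i * k + j)) k.
have hal i : size (al i) = k by rewrite size_mkseq.
pose ix i := m + index (block i (al i)) block_asgs.
exists [seq ix i | i <- iota 0 k]; split; first by rewrite size_map size_iota.
  apply/allP => _ /mapP[i + ->]; rewrite mem_iota => /andP[_ hi] /=.
  by rewrite ltn_add2l index_mem block_in.
move=> u hu.
have val x : x < k * k -> nth None (block (x %/ k) (al (x %/ k))) x = Some (a x).
  move=> hx; rewrite nth_block // -leq_divRL // leqnn -ltn_divLR // ltnSn /=.
  have e := divn_eq x k; have hm := ltn_pmod x k0.
  by rewrite nth_mkseq; [congr (Some (a _)); lia | lia].
have cov x : x < k * k -> clause_cov (ix (x %/ k)) u =
    clause_true (block (x %/ k) (al (x %/ k))) (nth [::] ext_clauses u).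
  move=> hx; rewrite /clause_cov /ix ltnNge leq_addr /= addKn nth_index //.
  by apply: block_in => //; rewrite ltn_divLR.
have fin x : x < k * k ->
   clause_true (block (x %/ k) (al (x %/ k))) (nth [::] ext_clauses u) ->
   has (clause_cov^~ u) [seq ix i | i <- iota 0 k].
  move=> hx h; apply/hasP; exists (ix (x %/ k)); last by rewrite cov.
  by apply: map_f; rewrite mem_iota /= add0n ltn_divLR.
have [[x hx e]|hF] := ext_nth hu.
  by apply: (fin x hx); rewrite e taut_true val.
have /hasP[l hl hal'] := ha _ hF.
have hlv : l.2 < k * k by move/allP: F_vars => /(_ _ hF) /allP /(_ l hl).
apply: (fin _ hlv); apply/hasP; exists l => //.
by rewrite val // (eqP hal').
Qed.

(** No member of [P] covers tautologies of two blocks, so the members [x_ i] found for the first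
    variable of each block are distinct and, being [k] in number, exhaust [P]. The tautology of the
    second variable of block [i] must then fall to [x_ i] as well, which is therefore not a
    singleton. *)
Lemma sat_of_cover P : is_cover k m q clause_cov P ->
  exists a : nat -> bool, all (has (fun l => a l.2 == l.1)) F.
Proof.
case=> hPk /allP hPq hP; have k0 : 0 < k by lia.
have base i d : i < k -> d < k -> i * k + d < k * k by nia.
have basediv i d : d < k -> (i * k + d) %/ k = i.
  by move=> hd; rewrite divnMDl // divn_small // addn0.
pose x_ i := nth 0 P (find (clause_cov^~ (taut_idx (i * k + 0))) P).
have hx i : i < k -> x_ i \in P /\ clause_cov (x_ i) (taut_idx (i * k + 0)).
  move=> hi; have h := hP _ (taut_idx_lt (base i 0 hi k0)).
  by split; [apply: mem_nth; rewrite -has_find | exact: (nth_find 0 h)].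
have cov1 x y z : x \in P -> y < k * k -> z < k * k -> clause_cov x (taut_idx y) ->
    clause_cov x (taut_idx z) -> y %/ k = z %/ k /\ (x < m -> y = z).
  move=> hxP hy hz; have hxq := hPq x hxP; rewrite /= in hxq; have [hxm|hxm] := ltnP x m.
    rewrite /clause_cov hxm => /eqP e1 /eqP e2.
    by have e := taut_idx_inj hy hz (etrans (esym e1) e2); split=> //; rewrite e.
  have [|i [al [_ _ _ hc]]] := @cov_asg x; first by rewrite hxm.
  by rewrite !hc // => /eqP-> /eqP->; split=> //; lia.
have xinj : {in iota 0 k &, injective x_}.
  move=> i j; rewrite !mem_iota !add0n => hi hj e.
  have [h1 c1] := hx i hi; have [h2 c2] := hx j hj.
  have := cov1 _ _ _ h1 (base i 0 hi k0) (base j 0 hj k0) c1; rewrite e => /(_ c2) [].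
  by rewrite !basediv.
have mem_x x : x \in P -> exists2 i, i < k & x = x_ i.
  move=> hxP; have us : uniq (map x_ (iota 0 k)) by rewrite map_inj_in_uniq ?iota_uniq.
  have sub : {subset map x_ (iota 0 k) <= P}.
    by move=> _ /mapP[i + ->]; rewrite mem_iota => /hx[].
  have [|_ e] := uniq_min_size us sub; first by rewrite size_map size_iota.
  move: hxP; rewrite -e => /mapP[i]; rewrite mem_iota => hi ->; by exists i.
have xm i : i < k -> m <= x_ i.
  move=> hi; have /hasP[x hxP c] := hP _ (taut_idx_lt (base i 1 hi k_gt1)).
  have [j hj e] := mem_x x hxP; have [_ c2] := hx j hj; rewrite e in hxP c.
  have [d1 d2] := cov1 _ _ _ hxP (base j 0 hj k0) (base i 1 hi k_gt1) c2 c.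
  rewrite !basediv // in d1; subst j.
  by rewrite leqNgt; apply/negP => /d2; lia.
have asg x : x \in P -> exists i al, [/\ i < k, x = x_ i, size al = k &
    nth [::] block_asgs (x - m) = block i al].
  move=> hxP; have [i hi e] := mem_x x hxP.
  have hxq := hPq x hxP; rewrite /= in hxq.
  have [|j [al [hj hal hb hc]]] := @cov_asg x; first by rewrite hxq {1}e xm.
  exists i, al; split=> //; rewrite hb; congr block.
  have [_] := hx i hi; rewrite -e hc ?basediv //; first by move/eqP.
  exact: base.
(* Different members assign different blocks, so at most one of them defines [y] and the glued
   assignment extends each of them. *)
pose a y := has (fun x => (m <= x) && (nth None (nth [::] block_asgs (x - m)) y == Some true)) P.
exists a; apply/allP => cl hcl.
have [u hu eu] := ext_index hcl.
have /hasP[x hxP hc] := hP u hu.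
have [i [al [hi e hal hb]]] := asg x hxP.
have hmx : m <= x by rewrite e xm.
move: hc; rewrite /clause_cov ltnNge hmx /= eu => /hasP[[b y] hl /= /eqP hv].
apply/hasP; exists (b, y) => //=; rewrite /a; case: b hl hv => hl hv.
  by rewrite eqb_id; apply/hasP; exists x => //; rewrite hmx hv /=.
rewrite eqbF_neg; apply/hasPn => x' hx'; rewrite negb_and; apply/orP; right.
have [i' [al' [hi' e' hal' hb']]] := asg x' hx'.
have d : y %/ k == i by rewrite -(block_defined _ _ hal) -hb hv.
apply/negP => /eqP hv'.
have d' : y %/ k == i' by rewrite -(block_defined _ _ hal') -hb' hv'.
have ei : i = i' by rewrite -(eqP d) (eqP d').
by move: hv'; rewrite e' -ei -e hv.
Qed.

Lemma cover_sat : (exists P, is_cover k m q clause_cov P) <->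
  exists a : nat -> bool, all (has (fun l => a l.2 == l.1)) F.
Proof. by split=> [[P]|]; [exact: sat_of_cover | exact: cover_of_sat]. Qed.

End CoverOfCnf.

(** * Programs on stacks *)

Definition letter_code (a : letter) : bool * bool :=
  match a with
  | L0 => (false, false) | L1 => (false, true)
  | LS => (true, false) | LT => (true, true) end.
Definition letter_decode (p : bool * bool) : letter :=
  match p with
  | (false, false) => L0 | (false, true) => L1
  | (true, false) => LS | (true, true) => LT end.
Lemma letter_codeK : cancel letter_code letter_decode. Proof. by case. Qed.
HB.instance Definition _ := Finite.copy letter (can_type letter_codeK).

Section Programs.

Inductive prog :=
  | Skip
  | Push of nat & letter
  | Seq of prog & prog
  | Loop of nat & (option letter -> bool) & (option letter -> prog).

Definition env := nat -> seq letter.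

Definition upd (e : env) (i : nat) (s : seq letter) : env :=
  fun j => if j == i then s else e j.

Definition popped (e : env) i : env := upd e i (behead (e i)).

(* [Loop i c f] pops stack [i], runs [f] on the popped symbol ([None] when the
   stack is empty) and starts over when [c] holds of that symbol. *)
Inductive exec : prog -> env -> env -> nat -> Prop :=
  | ExecSkip e : exec Skip e e 0
  | ExecPush i a e : exec (Push i a) e (upd e i (a :: e i)) 1
  | ExecSeq p q e e1 e2 t1 t2 :
      exec p e e1 t1 -> exec q e1 e2 t2 -> exec (Seq p q) e e2 (t1 + t2)
  | ExecExit i (c : option letter -> bool) f e e1 t1 :
      c (ohead (e i)) = false -> exec (f (ohead (e i))) (popped e i) e1 t1 ->
      exec (Loop i c f) e e1 t1.+1
  | ExecCont i (c : option letter -> bool) f e e1 e2 t1 t2 :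
      c (ohead (e i)) -> exec (f (ohead (e i))) (popped e i) e1 t1 ->
      exec (Loop i c f) e1 e2 t2 -> exec (Loop i c f) e e2 (t1 + t2).+1.

Lemma exec_size p e e' t :
  exec p e e' t -> forall i, size (e' i) <= size (e i) + t.
Proof.
elim=> {p e e' t} [e|i a e|p q e e1 e2 t1 t2 _ IH1 _ IH2|i c f e e1 t1 _ _ IH
                  |i c f e e1 e2 t1 t2 _ _ IH1 _ IH2] j.
- by rewrite addn0.
- by rewrite /upd; case: eqP => [->|_] /=; lia.
- by move: (IH1 j) (IH2 j); lia.
- move: (IH j); rewrite /popped /upd; case: eqP => [->|_]; rewrite ?size_behead; lia.
- move: (IH1 j) (IH2 j); rewrite /popped /upd; case: eqP => [->|_]; rewrite ?size_behead; lia.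
Qed.

Inductive instr :=
  | IPush of nat & letter & nat
  | IPop of nat & (option letter -> nat).

Definition oletters : seq (option letter) :=
  [:: None; Some L0; Some L1; Some LS; Some LT].

Definition otable (t0 t1 t2 t3 t4 : nat) (x : option letter) : nat :=
  match x with
  | None => t0 | Some L0 => t1 | Some L1 => t2 | Some LS => t3 | Some LT => t4
  end.

(* Code placed at address [o] that continues at address [nx]; the first
   component is the entry point. *)
Fixpoint compile (p : prog) (o nx : nat) : nat * seq instr :=
  match p with
  | Skip => (nx, [::])
  | Push i a => (o, [:: IPush i a nx])
  | Seq p q =>
      let: (eq, cq) := compile q o nx in
      let: (ep, cp) := compile p (o + size cq) eq in
      (ep, cq ++ cp)
  | Loop i c f =>
      let nxt x := if c x then o else nx in
      let: (e0, c0) := compile (f None) o.+1 (nxt None) in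
      let: (e1, c1) := compile (f (Some L0)) (o.+1 + size c0) (nxt (Some L0)) in
      let: (e2, c2) := compile (f (Some L1)) (o.+1 + size (c0 ++ c1)) (nxt (Some L1)) in
      let: (e3, c3) := compile (f (Some LS)) (o.+1 + size (c0 ++ c1 ++ c2)) (nxt (Some LS)) in
      let: (e4, c4) := compile (f (Some LT)) (o.+1 + size (c0 ++ c1 ++ c2 ++ c3)) (nxt (Some LT)) in
      (o, IPop i (otable e0 e1 e2 e3 e4) :: c0 ++ c1 ++ c2 ++ c3 ++ c4)
  end.

Definition code_at (code : seq instr) (o : nat) (c : seq instr) :=
  forall j, j < size c -> onth code (o + j) = onth c j.

Lemma code_at_cat code o c1 c2 :
  code_at code o (c1 ++ c2) -> code_at code o c1 /\ code_at code (o + size c1) c2.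
Proof.
move=> H; split=> j hj.
  rewrite H ?size_cat; last by lia.
  by rewrite !onthE map_cat nth_cat size_map hj.
rewrite -addnA H ?size_cat; last by lia.
by rewrite !onthE map_cat nth_cat size_map ltnNge leq_addr /= addKn.
Qed.

Lemma compile_loop i c f o nx code en cc :
  compile (Loop i c f) o nx = (en, cc) -> code_at code o cc ->
  en = o /\ exists tbl, onth code o = Some (IPop i tbl) /\
    forall x, exists o' c', compile (f x) o' (if c x then o else nx) = (tbl x, c')
      /\ code_at code o' c'.
Proof.
rewrite /=.
case h0: (compile (f None) _ _) => [e0 c0].
case h1: (compile (f (Some L0)) _ _) => [e1 c1].
case h2: (compile (f (Some L1)) _ _) => [e2 c2].
case h3: (compile (f (Some LS)) _ _) => [e3 c3].
case h4: (compile (f (Some LT)) _ _) => [e4 c4].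
case=> <- <- hc; split=> //; exists (otable e0 e1 e2 e3 e4); split.
  by rewrite -[o]addn0 (hc 0).
have {}hc : code_at code o.+1 (c0 ++ c1 ++ c2 ++ c3 ++ c4).
  by move=> j hj; have := hc j.+1 hj; rewrite addSnnS.
have [hc0 hr0] := code_at_cat hc.
have [hc1 hr1] := code_at_cat hr0.
have [hc2 hr2] := code_at_cat hr1.
have [hc3 hc4] := code_at_cat hr2.
rewrite !size_cat !addnA in h1 h2 h3 h4.
case=> [[]|]; eexists; eexists; split.
all: try eassumption.
Qed.

End Programs.

(** * Simulation by a Turing machine *)

Section FuelFacts.
Variable M : TM.
Local Notation step := (@step M).
Local Notation out_within := (@out_within M).

Fixpoint nsteps (n : nat) (c : config M) : option (config M) :=
  if n is n'.+1 then obind (nsteps n') (step c) else Some c.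

Lemma nsteps_add m n c c' c'' :
  nsteps m c = Some c' -> nsteps n c' = Some c'' -> nsteps (m + n) c = Some c''.
Proof.
elim: m c => [c [->] //|m IH c] /=.
by case: (step c) => //= c1; apply: IH.
Qed.

Lemma out_within_nsteps n t c c' :
  nsteps n c = Some c' -> out_within (n + t) c = out_within t c'.
Proof.
elim: n c => [c [->] //|n IH c] /=.
by case h: (step c) => [c1|] //= /IH.
Qed.

Lemma out_within_mono t t' c b :
  t <= t' -> out_within t c = Some b -> out_within t' c = Some b.
Proof.
elim: t t' c => [|t IH] [|t'] c //=; first by case: (step c).
by case h: (step c) => [c'|] //; apply: IH.
Qed.

End FuelFacts.

Section Machine.
Variables (M : TM) (code : seq instr) (entry : nat) (K : nat) (out : nat).

Local Notation MSt := 'I_((tm_q M).+1).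
Local Notation MSym := 'I_((tm_g M).+4.+1).
Local Notation track := 'I_K.+1.

(** [MInit] marks the origin. [MRet] walks back to the mark and there fetches the instruction at the
    program counter. [MPush] and [MPop] walk right to the first free cell of the track, and [MErase]
    clears the cell to the left of it. *)
Inductive mode := MInit | MRet | MPush | MPop | MErase.
Definition mode_code x : 'I_5 :=
  match x with MInit => inord 0 | MRet => inord 1 | MPush => inord 2
             | MPop => inord 3 | MErase => inord 4 end.
Definition mode_decode (i : 'I_5) :=
  match val i with 0 => MInit | 1 => MRet | 2 => MPush | 3 => MPop | _ => MErase end.
Lemma mode_codeK : cancel mode_code mode_decode.
Proof. by case; rewrite /mode_decode /= inordK. Qed.
HB.instance Definition _ := Finite.copy mode (can_type mode_codeK).

Definition gstate : finType := (('I_(size code).+1 * mode) + MSt)%type.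
(** The Boolean marks the origin. Symbols written by [M] form a summand of their own and replace all
    tracks of the cell. *)
Definition gsym : finType := ((bool * {ffun track -> option letter}) + MSym)%type.

Definition pc (n : nat) (md : mode) : gstate := inl (inord n, md).

Definition setc (tr : {ffun track -> option letter}) (i : nat) (x : option letter)
    : {ffun track -> option letter} :=
  [ffun j : track => if val j == i then x else tr j].

Definition getc (tr : {ffun track -> option letter}) (i : nat) : option letter :=
  tr (inord i).

(* What [M] sees when it is started on the tape of the stack machine. *)
Definition seen (x : gsym) : MSym :=
  match x with
  | inl (_, tr) => oapp (Defs.code M) (blank M) (getc tr out)
  | inr w => w
  end.

Definition mdelta (s : MSt) (x : gsym) : option (gstate * gsym * bool) :=
  if tm_delta s (seen x) is Some (s', w, b) then Some (inr s', inr w, b) else None.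

Definition gdelta (q : gstate) (x : gsym) : option (gstate * gsym * bool) :=
  match q with
  | inr s => mdelta s x
  | inl (n, md) =>
    match x with
    | inr _ => None
    | inl (mk, tr) =>
      match md, onth code n with
      | MInit, _ => Some (pc entry MRet, inl (true, tr), true)
      | MRet, None => if mk then mdelta ord0 x else Some (q, x, false)
      | MRet, Some (IPush i a nx) =>
          if ~~ mk then Some (q, x, false)
          else if getc tr i is None
               then Some (pc nx MRet, inl (mk, setc tr i (Some a)), true)
               else Some (pc n MPush, x, true)
      | MRet, Some (IPop i tbl) =>
          if ~~ mk then Some (q, x, false)
          else if getc tr i is None then Some (pc (tbl None) MRet, x, true)
               else Some (pc n MPop, x, true)
      | MPush, Some (IPush i a nx) =>
          if getc tr i is None
          then Some (pc nx MRet, inl (mk, setc tr i (Some a)), false)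
          else Some (q, x, true)
      | MPop, Some (IPop i tbl) =>
          if getc tr i is None then Some (pc n MErase, x, false)
          else Some (q, x, true)
      | MErase, Some (IPop i tbl) =>
          if getc tr i is Some a
          then Some (pc (tbl (Some a)) MRet, inl (mk, setc tr i None), true)
          else None
      | _, _ => None
      end
    end
  end.

(** If [M] halts without a single step, the state is still the one at hand-over, so it must answer
    like the start state of [M]. *)
Definition gacc (q : gstate) : bool :=
  match q with inr s => tm_acc s | inl _ => tm_acc (ord0 : MSt) end.

Definition gblank : gsym := inl (false, [ffun => None]).
Definition gletter (a : letter) : gsym := inl (false, setc [ffun => None] 0 (Some a)).

Definition dec_state (i : 'I_(#|gstate|).+1) : gstate :=
  if unlift ord0 i is Some j then enum_val j else pc 0 MInit.
Definition enc_state (q : gstate) : 'I_(#|gstate|).+1 := lift ord0 (enum_rank q).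
Lemma enc_stateK q : dec_state (enc_state q) = q.
Proof. by rewrite /dec_state /enc_state liftK enum_rankK. Qed.

(** The codes 0 to 4 are prescribed for the blank and the input letters; all symbols are coded again
    from 5 on. Decoding is thus not injective, and invariants speak of decoded symbols only. *)
Definition dec_sym (i : 'I_(#|gsym|).+4.+1) : gsym :=
  match @split 5 #|gsym| i with
  | inr j => enum_val j
  | inl j => match val j with
             | 0 => gblank | 1 => gletter L0 | 2 => gletter L1
             | 3 => gletter LS | _ => gletter LT end
  end.
Definition enc_sym (x : gsym) : 'I_(#|gsym|).+4.+1 := @rshift 5 #|gsym| (enum_rank x).
Lemma enc_symK x : dec_sym (enc_sym x) = x.
Proof.
rewrite /dec_sym /enc_sym.
have -> : @split 5 #|gsym| (@rshift 5 #|gsym| (enum_rank x)) = inr (enum_rank x).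
  by have := @unsplitK 5 #|gsym| (inr (enum_rank x)).
by rewrite enum_rankK.
Qed.

Definition machine : TM :=
  @MkTM #|gstate| #|gsym|
    (fun s x => if gdelta (dec_state s) (dec_sym x) is Some (q, y, b)
                then Some (enc_state q, enc_sym y, b) else None)
    (fun s => gacc (dec_state s)).

Lemma dec_sym_low (i : nat) : i < 5 ->
  dec_sym (inord i) = match i with
             | 0 => gblank | 1 => gletter L0 | 2 => gletter L1
             | 3 => gletter LS | _ => gletter LT end.
Proof.
move=> hi; rewrite /dec_sym.
have hi' : i < (#|gsym|).+4.+1 by lia.
case: splitP => j.
  by rewrite inordK // => ->.
rewrite inordK // => hj; lia.
Qed.

Lemma dec_sym_blank : dec_sym (blank machine) = gblank.
Proof. by rewrite /blank /= dec_sym_low. Qed.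
Lemma dec_sym_code a : dec_sym (Defs.code machine a) = gletter a.
Proof. by case: a; rewrite /Defs.code /= dec_sym_low. Qed.

(** * Tape contents and walks *)

Local Notation nthb := (nth (blank machine)).

(* The tape content as a function of the position, the leftmost cell ever
   visited having position 0. *)
Definition tape_at (c : config machine) (q : gstate) (p : nat) (t : nat -> gsym) :=
  let: (s, l, h, r) := c in
  [/\ dec_state s = q, size l = p, forall j, j < p -> dec_sym (nthb l j) = t (p - j.+1),
      dec_sym h = t p & forall j, dec_sym (nthb r j) = t (p + j.+1)].

Definition write (t : nat -> gsym) (p : nat) (x : gsym) : nat -> gsym :=
  fun j => if j == p then x else t j.

Lemma tape_at_ext c q p t t' : t =1 t' -> tape_at c q p t -> tape_at c q p t'.
Proof.
case: c => [[[s l] h] r] /= e [h1 h2 h3 h4 h5]; split=> //.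
- by move=> j hj; rewrite h3 // e.
- by rewrite h4 e.
- by move=> j; rewrite h5 e.
Qed.

Lemma step_right c q p t q' w :
  tape_at c q p t -> gdelta q (t p) = Some (q', w, true) ->
  exists2 c', @step machine c = Some c' & tape_at c' q' p.+1 (write t p w).
Proof.
case: c => [[[s l] h] r] [h1 h2 h3 h4 h5] hd.
rewrite /step /= h1 h4 hd; eexists; first by reflexivity.
case: r h5 => [|a r] h5; split; rewrite ?enc_stateK //=.
all: rewrite ?h2 //.
- move=> [|j] hj /=; rewrite /write; first by rewrite enc_symK subSS subn0 eqxx.
  rewrite h3 // subSS; case: eqP => // e; lia.
- rewrite /write; have := h5 0; rewrite /= addn1 => ->.
  by case: eqP => // ?; lia.
- move=> j; rewrite nth_nil; have := h5 j.+1; rewrite nth_nil /write => ->.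
  case: eqP => [?|_]; [lia|by congr t; lia].
- move=> [|j] hj /=; rewrite /write; first by rewrite enc_symK subSS subn0 eqxx.
  rewrite h3 // subSS; case: eqP => // e; lia.
- rewrite /write; have := h5 0; rewrite /= addn1 => ->.
  by case: eqP => // ?; lia.
- move=> j; have := h5 j.+1; rewrite /= /write => ->.
  case: eqP => [?|_]; [lia|by congr t; lia].
Qed.

Lemma step_left c q p t q' w :
  tape_at c q p.+1 t -> gdelta q (t p.+1) = Some (q', w, false) ->
  exists2 c', @step machine c = Some c' & tape_at c' q' p (write t p.+1 w).
Proof.
case: c => [[[s l] h] r] [h1 h2 h3 h4 h5] hd.
rewrite /step /= h1 h4 hd; eexists; first by reflexivity.
case: l h2 h3 => [|a l] //= [h2] h3; split; rewrite ?enc_stateK //.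
- move=> j hj; have := h3 j.+1; rewrite /= subSS => -> //.
  by rewrite /write; case: eqP => // ?; lia.
- have := h3 0; rewrite /= subSS subn0 /write => -> //.
  by case: eqP => // ?; lia.
- case=> [|j] /=; rewrite /write; first by rewrite enc_symK addn1 eqxx.
  rewrite h5; case: eqP => [?|_]; [lia|by congr t; lia].
Qed.

Lemma walk_right c q a n t :
  tape_at c q a t ->
  (forall j, a <= j < a + n -> gdelta q (t j) = Some (q, t j, true)) ->
  exists2 c', @nsteps machine n c = Some c' & tape_at c' q (a + n) t.
Proof.
elim: n c a => [c a hc _|n IH c a hc H].
  by exists c; rewrite ?addn0.
have [|c1 hs1 hc1] := step_right hc (H a _); first by lia.
have {}hc1 : tape_at c1 q a.+1 t.
  by apply: tape_at_ext hc1 => j; rewrite /write; case: eqP => [->|].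
have [|c2 hs2 hc2] := IH c1 a.+1 hc1; first by move=> j hj; apply: H; lia.
by exists c2; rewrite /= ?hs1 // -addSnnS.
Qed.

Lemma walk_left c q n t :
  tape_at c q n t ->
  (forall j, 0 < j <= n -> gdelta q (t j) = Some (q, t j, false)) ->
  exists2 c', @nsteps machine n c = Some c' & tape_at c' q 0 t.
Proof.
elim: n c => [c hc _|n IH c hc H]; first by exists c.
have [|c1 hs1 hc1] := step_left hc (H n.+1 _); first by lia.
have {}hc1 : tape_at c1 q n t.
  by apply: tape_at_ext hc1 => j; rewrite /write; case: eqP => [->|].
have [|c2 hs2 hc2] := IH c1 hc1; first by move=> j hj; apply: H; lia.
by exists c2; rewrite /= ?hs1.
Qed.

(* Stack [i] occupies track [i], bottom at the origin. *)
Definition cell (e : env) (i p : nat) : option letter := onth (rev (e i)) p.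

Definition tape_of (e : env) (p : nat) : gsym :=
  inl (p == 0, [ffun i : track => cell e i p]).

Definition ready (c : config machine) (n : nat) (e : env) :=
  tape_at c (pc n MRet) 0 (tape_of e).

Lemma cell_some e i p : p < size (e i) -> exists a, cell e i p = Some a.
Proof.
rewrite /cell -size_rev onthE => h; rewrite (nth_map L0) //; by eexists.
Qed.

Lemma cell_none e i p : size (e i) <= p -> cell e i p = None.
Proof. by rewrite /cell -size_rev => h; rewrite onthE nth_default // size_map. Qed.

Lemma getcE e i p : i <= K -> getc [ffun i : track => cell e i p] i = cell e i p.
Proof. by move=> hi; rewrite /getc ffunE inordK. Qed.

Lemma cell_push e i a p :
  cell (upd e i (a :: e i)) i p = if p == size (e i) then Some a else cell e i p.
Proof.
rewrite /cell /upd eqxx rev_cons !onthE map_rcons nth_rcons size_map size_rev.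
case: ltngtP => // h; rewrite nth_default // size_map size_rev; exact: ltnW.
Qed.

Lemma cell_pop e i a s p :
  e i = a :: s ->
  cell (popped e i) i p = if p == size s then None else cell e i p.
Proof.
move=> h; rewrite /cell /popped /upd eqxx h /= rev_cons !onthE map_rcons.
rewrite nth_rcons size_map size_rev.
by case: ltngtP => // h'; rewrite nth_default // size_map size_rev ?h' // ltnW.
Qed.

Lemma onth_ltn (s : seq instr) n x : onth s n = Some x -> n < size s.
Proof.
by rewrite onthE => h; rewrite ltnNge; apply/negP => h'; move: h; rewrite nth_default ?size_map.
Qed.

Lemma onth_inord n x : onth code n = Some x ->
  onth code (inord n : 'I_(size code).+1) = Some x.
Proof. by move=> h; rewrite inordK // ltnS ltnW // (onth_ltn h). Qed.

Lemma return_left c n p t :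
  tape_at c (pc n MRet) p t ->
  (forall j, 0 < j -> exists tr, t j = inl (false, tr)) ->
  exists2 c', @nsteps machine p c = Some c' & tape_at c' (pc n MRet) 0 t.
Proof.
move=> hc H; apply: walk_left hc _ => j /andP[hj _].
have [tr ->] := H j hj; rewrite /pc /=.
by case: onth => [[]|].
Qed.

Lemma tape_of_unmarked e j : 0 < j -> exists tr, tape_of e j = inl (false, tr).
Proof. by case: j => // j _; eexists. Qed.

Lemma write_push e i a :
  i <= K ->
  write (tape_of e) (size (e i))
    (inl (size (e i) == 0, setc [ffun j : track => cell e j (size (e i))] i (Some a)))
  =1 tape_of (upd e i (a :: e i)).
Proof.
move=> hi p; rewrite /write /tape_of; case: eqP => [->|hp]; congr (inl (_, _));
  apply/ffunP => j; rewrite !ffunE; case: (eqVneq (val j) i) => hj.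
- by rewrite hj cell_push eqxx.
- by rewrite /cell /upd (negbTE hj).
- by rewrite hj cell_push; move/eqP/negbTE: hp => ->.
- by rewrite /cell /upd (negbTE hj).
Qed.

Lemma write_pop e i a s :
  i <= K -> e i = a :: s ->
  write (tape_of e) (size s)
    (inl (size s == 0, setc [ffun j : track => cell e j (size s)] i None))
  =1 tape_of (popped e i).
Proof.
move=> hi he p; rewrite /write /tape_of; case: eqP => [->|hp]; congr (inl (_, _));
  apply/ffunP => j; rewrite !ffunE; case: (eqVneq (val j) i) => hj.
- by rewrite hj (cell_pop _ he) eqxx.
- by rewrite /cell /popped /upd (negbTE hj).
- by rewrite hj (cell_pop _ he); move/eqP/negbTE: hp => ->.
- by rewrite /cell /popped /upd (negbTE hj).
Qed.

(** The walk to the top and back accounts for [2 * size (e i)]. An empty stack has its free cell at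
    the origin; the head cannot stay there, so it steps right and returns. *)
Lemma push_sim c n i a nx e :
  onth code n = Some (IPush i a nx) -> i <= K -> ready c n e ->
  exists m c', [/\ m <= 2 * size (e i) + 4, @nsteps machine m c = Some c'
                 & ready c' nx (upd e i (a :: e i))].
Proof.
move=> hn hi hc; have hn' := onth_inord hn.
have unm := tape_of_unmarked (upd e i (a :: e i)).
have [he|he] := posnP (size (e i)).
  have hd : gdelta (pc n MRet) (tape_of e 0) =
     Some (pc nx MRet, inl (true, setc [ffun j : track => cell e j 0] i (Some a)), true).
    by rewrite /gdelta /= hn' /= getcE // cell_none // he.
  have [c1 hs1 hc1] := step_right hc hd.
  have wp := write_push e a hi; rewrite he in wp.
  have [c2 hs2 hc2] := return_left (tape_at_ext wp hc1) unm.
  exists 2, c2; split; rewrite ?leq_addl //=; first by lia.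
  by rewrite hs1 /= -hs2 /=; case: step.
have hd : gdelta (pc n MRet) (tape_of e 0) = Some (pc n MPush, tape_of e 0, true).
  rewrite /gdelta /= hn' /= getcE //; have [b ->] := cell_some he.
  by congr (Some (_, _, _)); rewrite /pc inord_val.
have [c1 hs1 hc1] := step_right hc hd.
have {}hc1 : tape_at c1 (pc n MPush) 1 (tape_of e).
  by apply: tape_at_ext hc1 => j; rewrite /write; case: eqP => [->|].
have [j hj|c2 hs2 hc2] := @walk_right _ _ 1 (size (e i)).-1 _ hc1.
  rewrite /gdelta /= hn' /= getcE //.
  by have [|b ->] := @cell_some e i j; first by lia.
have e1 : 1 + (size (e i)).-1 = size (e i) by lia.
rewrite e1 in hc2.
have hd2 : gdelta (pc n MPush) (tape_of e (size (e i))) =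
  Some (pc nx MRet, inl (size (e i) == 0,
        setc [ffun j : track => cell e j (size (e i))] i (Some a)), false).
  by rewrite /gdelta /= hn' /= getcE // cell_none.
have wp := write_push e a hi.
case hsz: (size (e i)) he hc2 hd2 wp hs2 => [//|z] _ hc2 hd2 wp hs2.
have [c3 hs3 hc3] := step_left hc2 hd2.
have [c4 hs4 hc4] := return_left (tape_at_ext wp hc3) unm.
exists (1 + (z + (1 + z))), c4; split; [lia| |done].
apply: (nsteps_add (m := 1) (c' := c1)); first by rewrite /= hs1.
apply: (nsteps_add hs2).
by apply: (nsteps_add (m := 1) (c' := c3)); first by rewrite /= hs3.
Qed.

Lemma pop_sim c n i tbl e :
  onth code n = Some (IPop i tbl) -> i <= K -> ready c n e ->
  exists m c', [/\ m <= 2 * size (e i) + 4, @nsteps machine m c = Some c'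
                 & ready c' (tbl (ohead (e i))) (popped e i)].
Proof.
move=> hn hi hc; have hn' := onth_inord hn.
case he: (e i) => [|a s].
  have hd : gdelta (pc n MRet) (tape_of e 0) =
     Some (pc (tbl None) MRet, tape_of e 0, true).
    by rewrite /gdelta /= hn' /= getcE // cell_none // he.
  have [c1 hs1 hc1] := step_right hc hd.
  have {}hc1 : tape_at c1 (pc (tbl None) MRet) 1 (tape_of (popped e i)).
    apply: tape_at_ext hc1 => j.
    have -> : popped e i = e.
      by apply: functional_extensionality => u; rewrite /popped /upd he; case: eqP => // ->.
    by rewrite /write; case: eqP => [->|].
  have [c2 hs2 hc2] := return_left hc1 (tape_of_unmarked _).
  exists 2, c2; split; rewrite ?leq_addl //=.
  by rewrite hs1 /= -hs2 /=; case: step.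
have sz : size (e i) = (size s).+1 by rewrite he.
have hd : gdelta (pc n MRet) (tape_of e 0) = Some (pc n MPop, tape_of e 0, true).
  rewrite /gdelta /= hn' /= getcE //; have [|b ->] := @cell_some e i 0; first by rewrite sz.
  by congr (Some (_, _, _)); rewrite /pc inord_val.
have [c1 hs1 hc1] := step_right hc hd.
have {}hc1 : tape_at c1 (pc n MPop) 1 (tape_of e).
  by apply: tape_at_ext hc1 => j; rewrite /write; case: eqP => [->|].
have [j hj|c2 hs2 hc2] := @walk_right _ _ 1 (size s) _ hc1.
  rewrite /gdelta /= hn' /= getcE //.
  by have [|b ->] := @cell_some e i j; first by lia.
have hd2 : gdelta (pc n MPop) (tape_of e (1 + size s)) =
  Some (pc n MErase, tape_of e (1 + size s), false).
  rewrite /gdelta /= hn' /= getcE // cell_none ?sz //.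
  by congr (Some (_, _, _)); rewrite /pc inord_val.
have [c3 hs3 hc3] := step_left hc2 hd2.
have {}hc3 : tape_at c3 (pc n MErase) (size s) (tape_of e).
  by apply: tape_at_ext hc3 => j; rewrite /write; case: eqP => [->|].
have hd3 : gdelta (pc n MErase) (tape_of e (size s)) =
  Some (pc (tbl (Some a)) MRet, inl (size s == 0,
        setc [ffun j : track => cell e j (size s)] i None), true).
  rewrite /gdelta /= hn' /= getcE //.
  by rewrite /cell he rev_cons onthE map_rcons nth_rcons size_map size_rev ltnn eqxx.
have [c4 hs4 hc4] := step_right hc3 hd3.
have [c5 hs5 hc5] := return_left (tape_at_ext (write_pop hi he) hc4) (tape_of_unmarked _).
exists (1 + (size s + (1 + (1 + (size s).+1)))), c5; split; rewrite /= ?he //; [lia|].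
apply: (nsteps_add (m := 1) (c' := c1)); first by rewrite /= hs1.
apply: (nsteps_add hs2).
apply: (nsteps_add (m := 1) (c' := c3)); first by rewrite /= hs3.
by apply: (nsteps_add (m := 1) (c' := c4)) hs5; rewrite /= hs4.
Qed.

Definition instr_ok (x : instr) :=
  match x with IPush i _ _ => i <= K | IPop i _ => i <= K end.

(** By [exec_size] no stack ever exceeds [B + t], so each of the [t] operations costs at most
    [2 * (B + t) + 4] machine steps. *)
Lemma exec_sim p e e' t :
  exec p e e' t -> all instr_ok code ->
  forall o nx en cc c B, compile p o nx = (en, cc) -> code_at code o cc ->
  ready c en e -> (forall i, size (e i) <= B) ->
  exists m c', [/\ m <= t * (2 * (B + t) + 4), @nsteps machine m c = Some c' & ready c' nx e'].
Proof.
move=> hex hok.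
have okn n x : onth code n = Some x -> instr_ok x.
  move=> h; have hn := onth_ltn h; move/all_nthP: hok => /(_ x n hn).
  by move: h; rewrite onthE (nth_map x) // => -[->].
elim: hex => {p e e' t} [e|i a e|p q e e1 e2 t1 t2 hp IHp hq IHq|i c f e e1 t1 hcf hf IHf
                  |i c f e e1 e2 t1 t2 hcf hf IHf hl IHl] o nx en cc cf B.
- by case=> <- <- _ h _; exists 0, cf.
- case=> <- <- hc hr hB.
  have h0 := hc 0 isT; rewrite addn0 /= in h0.
  have [m [c' [h1 h2 h3]]] := push_sim h0 (okn _ _ h0) hr.
  exists m, c'; split=> //; have := hB i; lia.
- rewrite /=; case hq': compile => [eq cq]; case hp': compile => [ep cp] [<- <-].
  move=> /code_at_cat [hcq hcp] hr hB.
  have [m1 [c1 [l1 s1 r1]]] := IHp _ _ _ _ _ _ hp' hcp hr hB.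
  have hB1 i : size (e1 i) <= B + t1 by have := exec_size hp i; have := hB i; lia.
  have [m2 [c2 [l2 s2 r2]]] := IHq _ _ _ _ _ _ hq' hcq r1 hB1.
  exists (m1 + m2), c2; split=> //; last exact: nsteps_add s1 s2.
  nia.
- move=> hcomp hcat; have [-> [tbl [hpop hbr]]] := compile_loop hcomp hcat.
  move=> hr hB.
  have [m1 [c1 [l1 s1 r1]]] := pop_sim hpop (okn _ _ hpop) hr.
  have [o' [c' [hc' hat]]] := hbr (ohead (e i)); rewrite hcf in hc'.
  have hB1 j : size (popped e i j) <= B.
    rewrite /popped /upd; case: eqP => [_|_] //; rewrite size_behead.
    by have := hB i; lia.
  have [m2 [c2 [l2 s2 r2]]] := IHf _ _ _ _ _ _ hc' hat r1 hB1.
  exists (m1 + m2), c2; split=> //; last exact: nsteps_add s1 s2.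
  have := hB i; nia.
- move=> hcomp hcat; have [eno [tbl [hpop hbr]]] := compile_loop hcomp hcat.
  subst en; move=> hr hB.
  have [m1 [c1 [l1 s1 r1]]] := pop_sim hpop (okn _ _ hpop) hr.
  have [o' [c' [hc' hat]]] := hbr (ohead (e i)); rewrite hcf in hc'.
  have hB1 j : size (popped e i j) <= B.
    rewrite /popped /upd; case: eqP => [_|_] //; rewrite size_behead.
    by have := hB i; lia.
  have [m2 [c2 [l2 s2 r2]]] := IHf _ _ _ _ _ _ hc' hat r1 hB1.
  have hB2 j : size (e1 j) <= B + t1 by have := exec_size hf j; have := hB1 j; lia.
  have [m3 [c3 [l3 s3 r3]]] := IHl _ _ _ _ _ _ hcomp hcat r2 hB2.
  exists (m1 + (m2 + m3)), c3; split=> //; last exact: nsteps_add s1 (nsteps_add s2 s3).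
  have := hB i; nia.
Qed.

(** Stacks have their bottom at the origin, so the first input letter is the bottom of stack 0. *)
Definition input_env (w : seq letter) : env := fun i => if i == 0 then rev w else [::].

Lemma init_ready w :
  exists2 c, @nsteps machine 2 (init machine w) = Some c & ready c entry (input_env w).
Proof.
pose t p : gsym := inl (false, [ffun i : track => cell (input_env w) i p]).
have h0 : tape_at (init machine w) (pc 0 MInit) 0 t.
  have dec_state0 : dec_state ord0 = pc 0 MInit by rewrite /dec_state unlift_none.
  have tE p : t p = if onth w p is Some a then gletter a else gblank.
    rewrite /t; case h: (onth w p) => [a|]; congr (inl (_, _)); apply/ffunP => i;
      rewrite !ffunE /cell /input_env.
    + by case: eqP => _; rewrite ?revK ?h // onthE nth_nil.
    + by case: eqP => _; rewrite ?revK ?h // onthE nth_nil.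
  clearbody t; rewrite /init; case: w tE => [|a w'] tE; split=> //.
  - by rewrite dec_sym_blank tE.
  - by move=> j; rewrite nth_nil dec_sym_blank tE.
  - by rewrite dec_sym_code tE.
  - move=> j; rewrite tE add0n /=.
    have [hj|hj] := ltnP j (size w').
      rewrite (nth_map L0) // dec_sym_code onthE (nth_map L0) //.
    by rewrite nth_default ?size_map // dec_sym_blank onthE nth_default ?size_map.
have hd : gdelta (pc 0 MInit) (t 0) =
  Some (pc entry MRet, inl (true, [ffun i : track => cell (input_env w) i 0]), true).
  by [].
have [c1 hs1 hc1] := step_right h0 hd.
have {}hc1 : tape_at c1 (pc entry MRet) 1 (tape_of (input_env w)).
  apply: tape_at_ext hc1 => j; rewrite /write /tape_of.
  by case: (eqVneq j 0) => [->|/negbTE hj].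
have [c2 hs2 hc2] := return_left hc1 (tape_of_unmarked _).
exists c2 => //; by apply: (@nsteps_add _ 1 1) hs2; rewrite /= hs1.
Qed.

(* Up to the projection [seen] and trailing blanks. *)
Definition mimics (c : config machine) (cM : config M) :=
  let: (s, l, h, r) := c in
  let: (sM, lM, hM, rM) := cM in
  [/\ dec_state s = inr sM \/ sM = ord0 /\ exists n tr,
        [/\ dec_state s = inl (n, MRet), onth code n = None & dec_sym h = inl (true, tr)],
      forall j, seen (dec_sym (nthb l j)) = nth (blank M) lM j,
      seen (dec_sym h) = hM &
      forall j, seen (dec_sym (nthb r j)) = nth (blank M) rM j].

Lemma seen_blank : seen (dec_sym (blank machine)) = blank M.
Proof. by rewrite dec_sym_blank /= /getc ffunE. Qed.

Lemma mimics_delta c cM : mimics c cM ->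
  gdelta (dec_state c.1.1.1) (dec_sym c.1.2) = mdelta cM.1.1.1 (dec_sym c.1.2)
  /\ gacc (dec_state c.1.1.1) = tm_acc cM.1.1.1.
Proof.
case: c => [[[s l] h] r]; case: cM => [[[sM lM] hM] rM] [] /= hs _ _ _.
case: hs => [-> //|[-> [n [tr [-> hn ->]]]]]; rewrite /= hn; by [].
Qed.

Lemma mimics_step c cM : mimics c cM ->
  match @step machine c, @step M cM with
  | Some c', Some cM' => mimics c' cM'
  | None, None => True
  | _, _ => False
  end.
Proof.
move=> hm; have [hd _] := mimics_delta hm; move: hm hd.
case: c => [[[s l] h] r]; case: cM => [[[sM lM] hM] rM] [] /= _ hl hh hr hd.
rewrite hd /mdelta hh; case: (tm_delta sM hM) => [[[s' w] []]|] //.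
- have hl' j : seen (dec_sym (nthb (enc_sym (inr w) :: l) j)) = nth (blank M) (w :: lM) j.
    by case: j => [|j] //=; rewrite enc_symK.
  case: r hr => [|a r] hr; case: rM hr => [|b rM] hr; split=> //;
    by [left; rewrite enc_stateK | exact: seen_blank
       | have := hr 0; rewrite /= ?seen_blank => <-
       | move=> j; have := hr j.+1; rewrite /= ?nth_nil].
- have hr' j : seen (dec_sym (nthb (enc_sym (inr w) :: r) j)) = nth (blank M) (w :: rM) j.
    by case: j => [|j] //=; rewrite enc_symK.
  case: l hl => [|a l] hl; case: lM hl => [|b lM] hl; split=> //;
    by [left; rewrite enc_stateK | exact: seen_blank
       | have := hl 0; rewrite /= ?seen_blank => <-
       | move=> j; have := hl j.+1; rewrite /= ?nth_nil].
Qed.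

Lemma mimics_out t c cM : mimics c cM ->
  @out_within machine t c = @out_within M t cM.
Proof.
have base c0 cM0 : mimics c0 cM0 ->
  (let: (s, _, _, _) := c0 in Some (@tm_acc machine s)) =
  (let: (s, _, _, _) := cM0 in Some (@tm_acc M s)).
  move=> /mimics_delta [_]; case: c0 => [[[? ?] ?] ?].
  by case: cM0 => [[[? ?] ?] ?] /= ->.
elim: t c cM => [|t IH] c cM hm; have := mimics_step hm; have := base _ _ hm;
  rewrite /=; case: (@step machine c) => [c'|]; case: (@step M cM) => [cM'|] // _.
exact: IH.
Qed.

(** Without an instruction at [n] the machine takes the first step of [M] at the origin. [M] reads a
    stack from the bottom, hence the reversal of [e out]. *)
Lemma ready_mimics c e n :
  onth code n = None -> n <= size code -> out <= K -> ready c n e ->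
  mimics c (init M (rev (e out))).
Proof.
move=> hn hle hout; case: c => [[[s l] h] r] [hs hl _ hh hr].
have hl0 : l = [::] by apply: size0nil.
have seenE p : seen (tape_of e p) = nth (blank M) (map (Defs.code M) (rev (e out))) p.
  rewrite /= getcE // /cell onthE.
  have [hp|hp] := ltnP p (size (rev (e out))).
    by rewrite !(nth_map L0).
  by rewrite !nth_default ?size_map.
have hst : dec_state s = inr ord0 \/ (ord0 : MSt) = ord0 /\ exists n tr,
        [/\ dec_state s = inl (n, MRet), onth code n = None & dec_sym h = inl (true, tr)].
  right; split=> //; exists (inord n); eexists; split; [exact: hs| |exact: hh].
  by rewrite inordK.
rewrite /init; case hw: (rev (e out)) seenE => [|a w] seenE; split=> //.
- by move=> j; rewrite hl0 !nth_nil seen_blank.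
- by rewrite hh seenE.
- by move=> j; rewrite hr seenE !nth_nil.
- by move=> j; rewrite hl0 !nth_nil seen_blank.
- by rewrite hh seenE.
- by move=> j; rewrite hr seenE.
Qed.

End Machine.

(** * A stack program followed by a machine *)

Fixpoint psize (p : prog) : nat :=
  match p with
  | Skip => 0
  | Push _ _ => 1
  | Seq p q => psize p + psize q
  | Loop _ _ f => (\sum_(x <- oletters) psize (f x)).+1
  end.

Fixpoint prog_ok (K : nat) (p : prog) : bool :=
  match p with
  | Skip => true
  | Push i _ => i <= K
  | Seq p q => prog_ok K p && prog_ok K q
  | Loop i _ f => (i <= K) && all (fun x => prog_ok K (f x)) oletters
  end.

Lemma size_compile p o nx : size (compile p o nx).2 = psize p.
Proof.
elim: p o nx => [|i a|p IHp q IHq|i c f IH] o nx //=.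
  case hq: compile => [eq cq]; case hp: compile => [ep cp] /=.
  by rewrite size_cat addnC -(IHp (o + size cq) eq) -(IHq o nx) hp hq.
case h0: (compile (f None) _ _) => [e0 c0].
case h1: (compile (f (Some L0)) _ _) => [e1 c1].
case h2: (compile (f (Some L1)) _ _) => [e2 c2].
case h3: (compile (f (Some LS)) _ _) => [e3 c3].
case h4: (compile (f (Some LT)) _ _) => [e4 c4] /=.
rewrite !size_cat !big_cons big_nil addn0; congr S.
do !congr addn.
- by rewrite -[c0]/((e0, c0).2) -h0 IH.
- by rewrite -[c1]/((e1, c1).2) -h1 IH.
- by rewrite -[c2]/((e2, c2).2) -h2 IH.
- by rewrite -[c3]/((e3, c3).2) -h3 IH.
- by rewrite -[c4]/((e4, c4).2) -h4 IH.
Qed.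

Lemma compile_ok K p o nx : prog_ok K p -> all (instr_ok K) (compile p o nx).2.
Proof.
elim: p o nx => [|i a|p IHp q IHq|i c f IH] o nx //=; first by rewrite andbT.
  case hq: compile => [eq cq]; case hp: compile => [ep cp] /= /andP[okp okq].
  by rewrite all_cat -[cp]/((ep, cp).2) -hp IHp // -[cq]/((eq, cq).2) -hq IHq.
case h0: (compile (f None) _ _) => [e0 c0].
case h1: (compile (f (Some L0)) _ _) => [e1 c1].
case h2: (compile (f (Some L1)) _ _) => [e2 c2].
case h3: (compile (f (Some LS)) _ _) => [e3 c3].
case h4: (compile (f (Some LT)) _ _) => [e4 c4] /=.
case/and5P=> -> ok0 ok1 ok2 /and3P[ok3 ok4 _]; rewrite !all_cat.
rewrite -[c0]/((e0, c0).2) -h0 IH // -[c1]/((e1, c1).2) -h1 IH //.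
rewrite -[c2]/((e2, c2).2) -h2 IH // -[c3]/((e3, c3).2) -h3 IH //.
by rewrite -[c4]/((e4, c4).2) -h4 IH.
Qed.

(** The exit address [psize p] is the length of the code, the first address without an instruction,
    where [M] takes over. *)
Definition run_before (M : TM) (p : prog) (K out : nat) : TM :=
  let ec := compile p 0 (psize p) in machine M ec.2 ec.1 K out.

Lemma run_before_out M p K out w w' e t f b :
  prog_ok K p -> out <= K -> exec p (input_env w) e t -> e out = rev w' ->
  @out_within M f (init M w') = Some b ->
  @out_within (run_before M p K out) (t * (2 * (size w + t) + 4) + 2 + f)
     (init _ w) = Some b.
Proof.
move=> okp hout hex he hM; rewrite /run_before.
have hsz := size_compile p 0 (psize p); have hok := @compile_ok K p 0 (psize p) okp.
case hc: (compile p 0 (psize p)) hsz hok => [en cc] /= hsz hok.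
have [c0 s0 r0] := init_ready M cc en K out w.
have hat : code_at cc 0 cc by move=> j _; rewrite add0n.
have hB i : size (input_env w i) <= size w.
  by rewrite /input_env; case: eqP => _; rewrite ?size_rev.
have [m [c1 [hm s1 r1]]] := exec_sim hex hok hc hat r0 hB.
have hend : onth cc (psize p) = None by rewrite onthE nth_default ?size_map ?hsz.
have hmim := ready_mimics hend _ hout r1; rewrite hsz leqnn he revK in hmim.
apply: (@out_within_mono _ (2 + m + f)); first by lia.
rewrite (out_within_nsteps _ (nsteps_add s0 s1)) (mimics_out _ (hmim isT)).
exact: hM.
Qed.

(** * Running times of programs *)

Definition run (p : prog) (e e' : env) (c : nat) : Prop :=
  exists2 t, t <= c & exec p e e' t.

Lemma run_le p e e' c c' : run p e e' c -> c <= c' -> run p e e' c'.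
Proof. by case=> t h1 h2 h3; exists t => //; apply: leq_trans h3. Qed.

Lemma run_skip e : run Skip e e 0.
Proof. by exists 0 => //; constructor. Qed.

Lemma run_push i a e e' : e' = upd e i (a :: e i) -> run (Push i a) e e' 1.
Proof. by move=> ->; exists 1 => //; constructor. Qed.

Lemma run_seq p q e e1 e2 c1 c2 :
  run p e e1 c1 -> run q e1 e2 c2 -> run (Seq p q) e e2 (c1 + c2).
Proof.
case=> t1 h1 x1 [t2 h2 x2]; exists (t1 + t2); first exact: leq_add.
exact: ExecSeq x1 x2.
Qed.

Lemma run_exit i (c : option letter -> bool) f e x s e1 t :
  (e i = if x is Some a then a :: s else [::]) ->
  (x = None -> s = [::]) -> c x = false ->
  run (f x) (upd e i s) e1 t -> run (Loop i c f) e e1 t.+1.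
Proof.
move=> he hn hc [t' ht hx]; exists t'.+1 => //.
have hx' : ohead (e i) = x by rewrite he; case: (x).
have hp : popped e i = upd e i s.
  by rewrite /popped he; case: (x) hn => //= /(_ erefl) ->.
by apply: ExecExit; rewrite hx' ?hp.
Qed.

Lemma run_cont i (c : option letter -> bool) f e a s e1 e2 t1 t2 :
  e i = a :: s -> c (Some a) ->
  run (f (Some a)) (upd e i s) e1 t1 -> run (Loop i c f) e1 e2 t2 ->
  run (Loop i c f) e e2 (t1 + t2).+1.
Proof.
move=> he hc [u1 h1 x1] [u2 h2 x2]; exists (u1 + u2).+1; first by rewrite ltnS leq_add.
by apply: (ExecCont (e1 := e1)); rewrite ?he //= /popped he.
Qed.

Lemma updE e i s : upd e i s i = s.
Proof. by rewrite /upd eqxx. Qed.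

Lemma updN e i j s : j != i -> upd e i s j = e j.
Proof. by rewrite /upd => /negbTE ->. Qed.

Ltac env_eq :=
  let v := fresh "v" in
  apply: functional_extensionality => v; rewrite /upd /=;
  repeat (let H := fresh "H" in case: (@eqP _ v _) => H; [subst v; simpl | ]);
  repeat (let H := fresh "H" in case: eqP => H);
  try congruence; try done.

Definition For (i : nat) (body : letter -> prog) : prog :=
  Loop i isSome (fun x => if x is Some a then body a else Skip).

(** [I d r] is the loop invariant: the letters [d] have been consumed and [r] is left on stack [i].
    The body starts with its letter already popped. *)
Lemma run_for i body s (I : seq letter -> seq letter -> env) c :
  (forall d r, s = d ++ r -> I d r i = r) ->
  (forall d a r, s = d ++ a :: r ->
     run (body a) (upd (I d (a :: r)) i r) (I (rcons d a) r) c) ->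
  run (For i body) (I [::] s) (upd (I s [::]) i [::]) (size s * c.+1).+1.
Proof.
move=> hI hb.
suff H d r : s = d ++ r ->
    run (For i body) (I d r) (upd (I s [::]) i [::]) (size r * c.+1).+1 by apply: H.
elim: r d => [|a r IH] d hs.
  rewrite cats0 in hs; apply: (@run_exit _ _ _ _ None [::]) => //.
    by rewrite hI // cats0.
  by rewrite -hs; apply: run_skip.
apply: (@run_le _ _ _ (c + (size r * c.+1).+1).+1); last by rewrite /=; lia.
apply: (@run_cont _ _ _ _ a r _ _ _ _ _ _ (hb d a r hs)) => //; first exact: hI.
by apply: IH; rewrite cat_rcons.
Qed.

Definition move i j : prog := For i (Push j).

Lemma run_conv p e1 e1' e e' c c' :
  run p e1 e1' c -> e1 = e -> e1' = e' -> c <= c' -> run p e e' c'.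
Proof. by move=> h <- <-; apply: run_le. Qed.

Lemma run_move i j e : i != j ->
  run (move i j) e (upd (upd e i [::]) j (catrev (e i) (e j))) (size (e i) * 2).+1.
Proof.
move=> /eqP hij; pose I d r := upd (upd e i r) j (catrev d (e j)).
apply: (run_conv (@run_for i (Push j) (e i) I 1 _ _)) => //.
- by move=> d r _; rewrite /I updN ?updE //; apply/eqP.
- by move=> d a r _; apply: run_push; rewrite /I -cats1 catrev_catl; env_eq.
- by rewrite /I; env_eq.
- by rewrite /I; env_eq.
Qed.

Fixpoint pushes (j : nat) (w : seq letter) : prog :=
  if w is a :: w' then Seq (Push j a) (pushes j w') else Skip.

Lemma run_pushes j w e : run (pushes j w) e (upd e j (catrev w (e j))) (size w).
Proof.
elim: w e => [|a w IH] e /=.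
  by apply: (run_conv (run_skip e)) => //; env_eq.
rewrite -add1n; apply: run_seq; first exact: run_push.
by apply: (run_conv (IH _)) => //; env_eq.
Qed.

(** Reading a stack destroys it; [t] keeps the letters so that stack [i] can be restored. *)
Definition scan i t j (f : letter -> seq letter) : prog :=
  Seq (For i (fun a => Seq (Push t a) (pushes j (f a)))) (move t i).

Lemma run_scan i t j f e : i != t -> i != j -> t != j -> e t = [::] ->
  (forall a, size (f a) <= 1) ->
  run (scan i t j f) e (upd e j (catrev (flatten (map f (e i))) (e j)))
    (size (e i) * 5 + 2).
Proof.
move=> /eqP hit /eqP hij /eqP htj ht hf.
pose I d r := upd (upd (upd e i r) t (rev d)) j (catrev (flatten (map f d)) (e j)).
apply: (@run_le _ _ _ ((size (e i) * 3).+1 + (size (e i) * 2).+1)); last by lia.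
apply: (run_seq (e1 := upd (I (e i) [::]) i [::])).
  apply: (run_conv (@run_for i _ (e i) I 2 _ _)) => //.
  - by move=> d r _; rewrite /I /upd; do !case: eqP => //; congruence.
  - move=> d a r _; rewrite -(addn1 1); apply: run_seq; first exact: run_push.
    apply: (run_conv (run_pushes _ _ _)) => //.
    rewrite /I map_rcons flatten_rcons catrev_catl rev_rcons; env_eq.
  - by rewrite /I; env_eq.
apply: (run_conv (run_move _ _)) => //; first by apply/eqP; congruence.
  by rewrite /I; env_eq; rewrite catrevE revK cats0.
by rewrite /I /upd; do !case: eqP => //; rewrite size_rev; lia.
Qed.

(* Lexicographic successor, least significant bit first. *)
Fixpoint nextb (s : seq bool) : option (seq bool) :=
  match s with
  | [::] => None
  | false :: s' => Some (true :: s')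
  | true :: s' => omap (cons false) (nextb s')
  end.

Fixpoint follows (s : seq bool) (l : seq (seq bool)) : Prop :=
  if l is s' :: l' then nextb s = Some s' /\ follows s' l' else nextb s = None.

Lemma bins_follows n : exists2 l, bins n = nseq n false :: l & follows (nseq n false) l.
Proof.
elim: n => [|n [l IH hf]]; first by exists [::].
exists ((true :: nseq n false) :: flatten [seq [:: false :: s; true :: s] | s <- l]).
  by rewrite /= IH.
rewrite /=; split=> //; elim: l (nseq n false) hf {IH} => [|s' l IH] s /=; first by move=> ->.
by case=> -> /= hf; split=> //; split=> //; apply: IH.
Qed.

Definition nextw (s : seq bool) := odflt (nseq (size s) false) (nextb s).

Lemma size_nextb s s' : nextb s = Some s' -> size s' = size s.
Proof.
elim: s s' => [|[] s IH] s' //=; last by case=> <-.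
by case: (nextb s) IH => //= s1 IH [<-] /=; rewrite (IH s1).
Qed.

(** Leading separators are passed over and the carry turns ones into zeros. A flag on [g] reports
    that no overflow occurred; after an overflow all digits are zero, ready for another pass. *)
Definition incr i g t : prog :=
  Seq (Loop i (fun x => match x with Some LS | Some L1 => true | _ => false end)
    (fun x => match x with
              | Some LS => Push t LS
              | Some L1 => Push t L0
              | Some L0 => Seq (Push i L1) (Push g L1)
              | _ => Skip
              end)) (move t i).

(** Generalized to letters [u] already set aside, for the induction. The stacks [y] and [v] are the
    two parts into which the counter is split when the loop stops; only their concatenation
    matters. *)
Lemma run_incr_loop i g t e s u gg p : i != t -> i != g -> t != g ->
  exists y v, [/\ run (incr i g t) (upd (upd (upd e i (nseq p LS ++ map bit s)) t u) g gg)
     (upd (upd (upd e i (catrev v y)) t [::]) g (if nextb s is Some _ then L1 :: gg else gg))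
     ((p + size s) * 4 + size u * 2 + 4) &
     catrev v y = catrev u (nseq p LS ++ map bit (nextw s))].
Proof.
move=> hit hig htg; rewrite /incr; set lp := Loop _ _ _.
suff [y [v [h1 h2 h3]]] : exists y v,
   [/\ run lp (upd (upd (upd e i (nseq p LS ++ map bit s)) t u) g gg)
     (upd (upd (upd e i y) t v) g (if nextb s is Some _ then L1 :: gg else gg))
     ((p + size s) * 2 + 3),
     catrev v y = catrev u (nseq p LS ++ map bit (nextw s)) &
     size v <= size u + p + size s].
  exists y, v; split=> //; apply: (@run_le _ _ _ (((p + size s) * 2 + 3) + (size v * 2).+1)).
    apply: (run_seq h1); apply: (run_conv (run_move _ _)); first by rewrite eq_sym.
    - by [].
    - move/eqP: hit => hit; move/eqP: hig => hig; move/eqP: htg => htg.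
      have -> : upd (upd (upd e i y) t v) g
        (if nextb s is Some _ then L1 :: gg else gg) t = v.
        by rewrite /upd; case: eqP => [?|_]; rewrite ?eqxx; congruence.
      have -> : upd (upd (upd e i y) t v) g
        (if nextb s is Some _ then L1 :: gg else gg) i = y.
        by rewrite /upd; case: eqP => [?|_]; [congruence|]; case: eqP => [?|_]; [congruence|]; rewrite eqxx.
      by env_eq.
    - by rewrite /upd (negbTE htg) eqxx.
  by clear - h3; lia.
move/eqP: hit => hit; move/eqP: hig => hig; move/eqP: htg => htg.
have ei x y z : upd (upd (upd e i x) t y) g z i = x.
  by rewrite /upd; case: eqP => [?|_]; [congruence|]; case: eqP => [?|_]; [congruence|]; rewrite eqxx.
have et x y z : upd (upd (upd e i x) t y) g z t = y.
  by rewrite /upd; case: eqP => [?|_]; [congruence|]; rewrite eqxx.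
elim: p u => [|p IH] u; last first.
  have [y [v [h1 h2 h3]]] := IH (LS :: u).
  exists y, v; split=> //; last by rewrite /= in h3; lia.
  apply: (@run_le _ _ _ (1 + ((p + size s) * 2 + 3)).+1); last by lia.
  apply: (@run_cont _ _ _ _ LS (nseq p LS ++ map bit s)) h1 => //.
  by apply: run_push; env_eq.
rewrite /nextw add0n addn0 /=.
elim: s u => [|[] s IH] u /=.
- exists [::], u; split=> //; last by lia.
  apply: (@run_le _ _ _ 1) => //.
  apply: (@run_exit _ _ _ _ None [::]) => //.
  by apply: (run_conv (run_skip _)) => //; env_eq.
- have [y [v [h1 h2 h3]]] := IH (L0 :: u).
  exists y, v; split=> //; last by rewrite /= in h3; lia.
    apply: (@run_le _ _ _ (1 + (size s * 2 + 3)).+1); last by lia.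
    apply: (@run_cont _ _ _ _ L1 (map bit s)) => //.
      by apply: run_push; reflexivity.
    by apply: (run_conv h1) => //; first env_eq; by case: (nextb s).
  by rewrite h2 /=; case: (nextb s).
- exists (L1 :: map bit s), u; split=> //; last by lia.
  apply: (@run_le _ _ _ (1 + 1).+1); last by lia.
  apply: (@run_exit _ _ _ _ (Some L0) (map bit s)) => //.
  apply: run_seq; first exact: run_push.
  by apply: run_push; env_eq.
Qed.

Lemma run_incr i g t e s p : i != t -> i != g -> t != g ->
  e i = nseq p LS ++ map bit s -> e t = [::] ->
  run (incr i g t) e
    (upd (upd e i (nseq p LS ++ map bit (nextw s))) g
       (if nextb s is Some _ then L1 :: e g else e g)) ((p + size s) * 4 + 4).
Proof.
move=> hit hig htg he ht.
have [y [v [h1 /= h2]]] := run_incr_loop e s [::] (e g) p hit hig htg.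
apply: (run_conv h1); rewrite ?h2 ?addn0 //.
  by rewrite -he -ht; env_eq.
move/eqP: hit => hit; move/eqP: hig => hig; move/eqP: htg => htg.
by case: (nextb s) => [s'|]; env_eq.
Qed.

Notation vO := 14 (only parsing).

(* The stack [vO] holds the reversed output. *)
Definition emits (p : prog) (e : env) (w : seq letter) (c : nat) : Prop :=
  forall o, run p (upd e vO o) (upd e vO (catrev w o)) c.

Lemma emits_le p e w c c' : emits p e w c -> c <= c' -> emits p e w c'.
Proof. by move=> h hc o; apply: run_le hc. Qed.

Lemma emits_seq p q e w1 w2 c1 c2 :
  emits p e w1 c1 -> emits q e w2 c2 -> emits (Seq p q) e (w1 ++ w2) (c1 + c2).
Proof. by move=> h1 h2 o; rewrite catrev_catl; apply: run_seq. Qed.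

Lemma emits_push a e : emits (Push vO a) e [:: a] 1.
Proof. by move=> o; apply: run_push; env_eq. Qed.

Lemma emits_scan i t f e : i != t -> i != vO -> t != vO -> e t = [::] ->
  (forall a, size (f a) <= 1) ->
  emits (scan i t vO f) e (flatten (map f (e i))) (size (e i) * 5 + 2).
Proof.
move=> hit hi ht et hf o; apply: (run_conv (@run_scan i t vO f (upd e vO o) _ _ _ _ _)) => //.
- by rewrite updN.
- by rewrite [upd e vO o i]updN // updE; env_eq.
- by rewrite updN.
Qed.

(** [g] is nonempty as long as another value of the counter is due, and the overflow of [incr] ends
    the loop. *)
Definition bins_loop i g t body : prog :=
  Seq (Push g L1)
    (Loop g isSome (fun x => if x is Some _ then Seq body (incr i g t) else Skip)).

Lemma emits_bins i g t body e p n h c :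
  i != t -> i != g -> t != g -> i != vO -> g != vO -> t != vO ->
  e i = nseq p LS ++ nseq n L0 -> e g = [::] -> e t = [::] ->
  (forall s, size s = n -> emits body (upd e i (nseq p LS ++ map bit s)) (h s) c) ->
  emits (bins_loop i g t body) e (flatten (map h (bins n)))
    (2 ^ n * (c + (p + n) * 4 + 5) + 2).
Proof.
move=> hit hig htg hio hgo hto ei eg et hb o.
have [l hl hf] := bins_follows n.
move: (hit) (hig) (htg) (hio) (hgo) (hto) => /eqP hit' /eqP hig' /eqP htg' /eqP hio' /eqP hgo' /eqP hto'.
rewrite /bins_loop; set lp := Loop _ _ _.
suff H s : size s = n -> follows s l ->
   run lp (upd (upd (upd e i (nseq p LS ++ map bit s)) g [:: L1]) vO o)
          (upd e vO (catrev (flatten (map h (s :: l))) o))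
          ((size l).+1 * (c + (p + n) * 4 + 5) + 1).
  apply: (@run_le _ _ _ (1 + ((size l).+1 * (c + (p + n) * 4 + 5) + 1))); last first.
    by rewrite -size_bins hl /= addnCA.
  apply: run_seq; first by apply: run_push; reflexivity.
  rewrite hl; apply: (run_conv (H (nseq n false) _ hf)) => //; first by rewrite size_nseq.
  by rewrite map_nseq -ei updN // eg; env_eq.
have hinc s0 e0 : size s0 = n -> e0 i = nseq p LS ++ map bit s0 -> e0 t = [::] ->
    run (incr i g t) e0 (upd (upd e0 i (nseq p LS ++ map bit (nextw s0))) g
       (if nextb s0 is Some _ then L1 :: e0 g else e0 g)) ((p + n) * 4 + 4).
  by move=> <-; apply: run_incr.
elim: l {hl hf} s o => [|s' l IH] s o hs hf.
  apply: (@run_le _ _ _ (((c + ((p + n) * 4 + 4)) + 1).+1)); last by lia.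
  apply: (@run_cont _ _ _ _ L1 [::]) => //; first by rewrite updN // updE.
  - apply: run_seq.
      apply: (run_conv (hb s hs o)) => //.
      by rewrite -eg; env_eq.
    by apply: (hinc s) => //; [rewrite updN // updE | rewrite !updN // eq_sym].
  - apply: (@run_exit _ _ _ _ None [::]) => //.
      rewrite updE /= in hf *; rewrite hf !updN //; first by rewrite eq_sym.
    apply: (run_conv (run_skip _)) => //.
    rewrite /= in hf; rewrite /nextw hf /= map_nseq hs -[nseq n (bit false)]/(nseq n L0) -ei cats0.
    by rewrite -eg; env_eq.
have [hn hf'] := hf.
have hs' : size s' = n by rewrite (size_nextb hn).
apply: (@run_le _ _ _ (((c + ((p + n) * 4 + 4)) +
     ((size l).+1 * (c + (p + n) * 4 + 5) + 1)).+1)); last by rewrite /=; lia.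
apply: (@run_cont _ _ _ _ L1 [::]) => //; first by rewrite updN // updE.
- apply: run_seq.
    apply: (run_conv (hb s hs o)) => //.
    by rewrite -eg; env_eq.
  by apply: (hinc s) => //; [rewrite updN // updE | rewrite !updN // eq_sym].
- apply: (run_conv (IH s' (catrev (h s) o) hs' hf')) => //; last by rewrite /= !catrev_catl.
  by rewrite /nextw hn /= !updN ?eg //; [env_eq | rewrite eq_sym].
Qed.

(** * A program for the reduction *)

(* [vF] text of the clauses not yet visited, [vE] reversed text of those visited,
   [vC] and [vD] current clause, [vK] the number [k] in unary, [vZ] and [vW] the
   cube vertex and the block assignment, both run through as binary counters with
   flags [vH] and [vG], [vP] weight of the vertex, [vB] sign of the current literal,
   [vR] result of an evaluation, [vN] number of variables, [vL], [vV] and [vX] loop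
   counters, [vT] and [vU] scratch. *)
Notation vF := 1 (only parsing).
Notation vK := 2 (only parsing).
Notation vZ := 3 (only parsing).
Notation vW := 4 (only parsing).
Notation vT := 5 (only parsing).
Notation vG := 6 (only parsing).
Notation vH := 7 (only parsing).
Notation vP := 8 (only parsing).
Notation vC := 9 (only parsing).
Notation vD := 10 (only parsing).
Notation vE := 11 (only parsing).
Notation vB := 12 (only parsing).
Notation vR := 13 (only parsing).
Notation vN := 15 (only parsing).
Notation vU := 16 (only parsing).
Notation vV := 17 (only parsing).
Notation vL := 18 (only parsing).
Notation vX := 19 (only parsing).

Definition once (_ : option letter) := false.

(** * Evaluating a clause under a partial assignment *)

Definition enc_lit (l : bool * nat) : seq letter := bit l.1 :: nseq l.2 L1 ++ [:: LS].
Definition enc_clause (cl : seq (bool * nat)) : seq letter := flatten (map enc_lit cl).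
Definition enc_clauses (cls : seq (seq (bool * nat))) : seq letter :=
  flatten [seq enc_clause cl ++ [:: LT] | cl <- cls].

Definition enc_val (x : option bool) : letter := oapp bit LS x.

(** [L1] is both the positive sign and the unary digit; it is a sign exactly when [vB] is empty.
    Each digit moves one value from [vW] to [vU], so that at the separator the value of the variable
    is on top of [vW]; afterwards [vW] is restored. *)
Definition eval_char (a : letter) : prog :=
  match a with
  | L0 => Push vB L0
  | L1 => Loop vB once (fun x =>
      match x with
      | None => Push vB L1
      | Some b => Seq (Push vB b)
          (Loop vW once (fun x => if x is Some c then Push vU c else Skip))
      end)
  | LS => Loop vB once (fun b =>
      Seq (Loop vW once (fun c =>
             Seq (if c is Some c' then Push vW c' else Skip)
                 (if (b == c) && (b != None) then Push vR L1 else Skip)))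
          (move vU vW))
  | LT => Skip
  end.

Definition eval_loop : prog := For vD (fun a => Seq (Push vT a) (eval_char a)).

Section Eval.
Variable e : env.

Definition est (d t w u b r : seq letter) : env :=
  upd (upd (upd (upd (upd (upd e vD d) vT t) vW w) vU u) vB b) vR r.

Lemma eval_step a d t w u b r w' u' b' r' e2 c c2 :
  run (eval_char a) (est d (a :: t) w u b r) (est d (a :: t) w' u' b' r') c ->
  run eval_loop (est d (a :: t) w' u' b' r') e2 c2 ->
  run eval_loop (est (a :: d) t w u b r) e2 (c + c2 + 2).
Proof.
move=> h1 h2; apply: (@run_le _ _ _ ((1 + c) + c2).+1); last by lia.
apply: (@run_cont _ _ _ _ a d) h2 => //.
apply: run_seq; first by apply: run_push; reflexivity.
by apply: (run_conv h1) => //; rewrite /est; env_eq.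
Qed.

Lemma eval_sign s d t w r e2 c2 :
  run eval_loop (est d (bit s :: t) w [::] [:: bit s] r) e2 c2 ->
  run eval_loop (est (bit s :: d) t w [::] [::] r) e2 (c2 + 10).
Proof.
move=> h; apply: (@run_le _ _ _ (2 + c2 + 2)); last by lia.
apply: eval_step h; case: s => /=.
  apply: (@run_exit _ _ _ _ None [::]) => //.
  by apply: run_push; rewrite /est; env_eq.
by apply: (@run_le _ _ _ 1) => //; apply: run_push; rewrite /est; env_eq.
Qed.

Lemma eval_index x d t w u r e2 c2 :
  run eval_loop (est d (L1 :: t) (behead w) (catrev (take 1 w) u) [:: x] r) e2 c2 ->
  run eval_loop (est (L1 :: d) t w u [:: x] r) e2 (c2 + 10).
Proof.
move=> h; apply: (@run_le _ _ _ ((1 + 2).+1 + c2 + 2)); last by lia.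
apply: eval_step h => /=.
apply: (@run_exit _ _ _ _ (Some x) [::]) => //.
apply: run_seq; first by apply: run_push; reflexivity.
case: w => [|c w] /=.
  apply: (@run_le _ _ _ 1) => //; apply: (@run_exit _ _ _ _ None [::]) => //.
  by apply: (run_conv (run_skip _)) => //; rewrite /est; env_eq.
apply: (@run_exit _ _ _ _ (Some c) w) => //.
by apply: run_push; rewrite /est take0 /=; env_eq.
Qed.

Lemma eval_indices n x d t w r e2 c2 :
  run eval_loop (est d (nseq n L1 ++ t) (drop n w) (rev (take n w)) [:: x] r) e2 c2 ->
  run eval_loop (est (nseq n L1 ++ d) t w [::] [:: x] r) e2 (c2 + 10 * n).
Proof.
rewrite -[rev _]cats0 -catrevE.
suff H u : run eval_loop
    (est d (nseq n L1 ++ t) (drop n w) (catrev (take n w) u) [:: x] r) e2 c2 ->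
  run eval_loop (est (nseq n L1 ++ d) t w u [:: x] r) e2 (c2 + 10 * n) by apply: H.
elim: n t w u => [|n IH] t w u.
  by rewrite muln0 addn0 drop0 take0.
move=> h; apply: (@run_le _ _ _ (c2 + 10 * n + 10)); last by lia.
rewrite -[nseq n.+1 L1 ++ d]/(L1 :: (nseq n L1 ++ d)).
apply: eval_index; apply: IH; apply: (run_conv h) => //.
have -> : nseq n L1 ++ L1 :: t = nseq n.+1 L1 ++ t.
  by clear; elim: n => //= n ->.
by case: w {h} => //= c w; rewrite take0.
Qed.

Lemma eval_sep x d t w u r e2 c2 :
  run eval_loop (est d (LS :: t) (catrev u w) [::] [::]
    (if ohead w == Some x then L1 :: r else r)) e2 c2 ->
  run eval_loop (est (LS :: d) t w u [:: x] r) e2 (c2 + 2 * size u + 10).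
Proof.
move=> h; apply: (@run_le _ _ _ (((1 + 1).+1 + (size u * 2).+1).+1 + c2 + 2)); last by lia.
apply: eval_step h => /=.
apply: (@run_exit _ _ _ _ (Some x) [::]) => //.
apply: (run_seq (e1 := est d (LS :: t) w u [::] (if ohead w == Some x then L1 :: r else r))).
  case: w => [|c w] /=.
    apply: (@run_exit _ _ _ _ None [::]) => //.
    apply: (@run_le _ _ _ 0) => //.
    apply: (@run_seq _ _ _ _ _ 0 0 (run_skip _)).
    by apply: (run_conv (run_skip _)) => //; rewrite /est; env_eq.
  apply: (@run_exit _ _ _ _ (Some c) w) => //.
  apply: run_seq; first by apply: run_push; reflexivity.
  rewrite andbT eq_sym; case: eqP => _.
    by apply: run_push; rewrite /est; env_eq.
  by apply: (run_conv (run_skip _)) => //; rewrite /est; env_eq.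
by apply: (run_conv (run_move _ _)) => //; rewrite /est; env_eq.
Qed.

Lemma eval_literal (l : bool * nat) (w : seq (option bool)) d t r e2 c2 :
  run eval_loop (est d (catrev (enc_lit l) t) (map enc_val w) [::] [::]
     (if nth None w l.2 == Some l.1 then L1 :: r else r)) e2 c2 ->
  run eval_loop (est (enc_lit l ++ d) t (map enc_val w) [::] [::] r) e2
     (c2 + 2 * size w + 10 * size (enc_lit l)).
Proof.
case: l => s n /= h.
rewrite size_cat size_nseq /= -catA.
apply: (@run_le _ _ _ (c2 + 2 * size w + 10 + 10 * n + 10)); last by lia.
apply: eval_sign; apply: eval_indices.
apply: (@run_le _ _ _ (c2 + 2 * size (rev (take n (map enc_val w))) + 10)); last first.
  by rewrite size_rev size_take size_map; case: ifP; lia.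
apply: eval_sep; apply: (run_conv h) => //.
(* An undefined value is written [LS], which is no sign, and past the end of [w] both comparisons
   fail. *)
have -> : (ohead (drop n (map enc_val w)) == Some (bit s)) = (nth None w n == Some s).
  elim: w n {h} => [|y w IH] [|n] //=.
  by case: y => [[]|]; case: (s).
rewrite [catrev (rev _) _]catrevE revK cat_take_drop.
congr est; rewrite catrev_catl /= catrevE rev_nseq; by [].
Qed.

Lemma eval_clause (cl : seq (bool * nat)) (w : seq (option bool)) t r :
  run eval_loop (est (enc_clause cl) t (map enc_val w) [::] [::] r)
     (est [::] (catrev (enc_clause cl) t) (map enc_val w) [::] [::]
       (nseq (count (fun l => nth None w l.2 == Some l.1) cl) L1 ++ r))
     (size (enc_clause cl) * (2 * size w + 10) + 1).
Proof.
elim: cl t r => [|l cl IH] t r.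
  apply: (@run_exit _ _ _ _ None [::]) => //.
  by apply: (run_conv (run_skip _)) => //; rewrite /est /=; env_eq.
rewrite /enc_clause /= -/(enc_clause cl).
apply: (run_le (eval_literal (c2 := size (enc_clause cl) * (2 * size w + 10) + 1) _)).
  apply: (run_conv (IH _ _)) => //.
  rewrite catrev_catl; congr est; case: eqP => _ //=.
  by elim: count => //= m ->.
by rewrite size_cat /=; nia.
Qed.

End Eval.

(* Clears [vR], which holds one symbol for each true literal. *)
Definition emit_eval : prog :=
  Seq (Seq eval_loop (move vT vD))
    (Seq (Loop vR once (fun x => Push vO (if x is Some _ then L1 else L0)))
         (For vR (fun _ => Skip))).

Lemma run_clear i e : run (For i (fun _ => Skip)) e (upd e i [::]) (size (e i)).+1.
Proof.
apply: (run_conv (@run_for i _ (e i) (fun d r => upd e i r) 0 _ _)) => //.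
- by move=> d r _; rewrite updE.
- by move=> d a r _; apply: (run_conv (run_skip _)) => //; env_eq.
- by env_eq.
- by env_eq.
- by rewrite muln1.
Qed.

Lemma emits_eval e cl w :
  e vD = enc_clause cl -> e vW = map enc_val w -> e vT = [::] -> e vU = [::] ->
  e vB = [::] -> e vR = [::] ->
  emits emit_eval e [:: bit (clause_true w cl)] (size (enc_clause cl) * (2 * size w + 13) + 10).
Proof.
move=> eD eW eT eU eB eR o.
set n := count (fun l : bool * nat => nth None w l.2 == Some l.1) cl.
have hn : n <= size (enc_clause cl).
  apply: leq_trans (count_size _ _) _; rewrite /enc_clause.
  by elim: (cl) => //= l l' IH; rewrite size_cat /=; lia.
apply: (@run_le _ _ _ (((size (enc_clause cl) * (2 * size w + 10) + 1) +
   (size (enc_clause cl) * 2).+1) + (2 + n.+1))); last by nia.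
apply: (run_seq (e1 := upd (upd e vO o) vR (nseq n L1))).
  apply: run_seq.
    apply: (run_conv (eval_clause (upd e vO o) cl w [::] [::])) => //.
    by rewrite /est -eD -eW; env_eq.
  apply: (run_conv (run_move _ _)) => //.
    by rewrite /est cats0 /= ; env_eq; rewrite ?eD ?eW // catrevE cats0 revK.
  by rewrite /est /upd /= catrevE cats0 size_rev.
have -> : clause_true w cl = (0 < n) by rewrite /clause_true has_count.
apply: (run_seq (e1 := upd (upd e vO (catrev [:: bit (0 < n)] o)) vR (nseq n.-1 L1))).
  case: n {hn} => [|n] /=.
    apply: (@run_exit _ _ _ _ None [::]) => //.
    by apply: run_push; env_eq.
  apply: (@run_exit _ _ _ _ (Some L1) (nseq n L1)) => //.
  by apply: run_push; env_eq.
apply: (run_conv (run_clear _ _)) => //.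
  by env_eq.
by rewrite updE size_nseq; lia.
Qed.

(* [vW] holds [i * k] separators followed by a counter, which encodes the
   assignments of block [i]. *)
Definition cols (body : prog) : prog :=
  Seq (scan vK vT vW (fun _ => [:: L0]))
  (Seq (scan vK vT vL (fun _ => [:: L1]))
  (Seq (For vL (fun _ => Seq (bins_loop vW vG vT body) (scan vK vT vW (fun _ => [:: LS]))))
       (For vW (fun _ => Skip)))).

Lemma flatten_map_nseq (T : Type) (s : seq T) (a : letter) :
  flatten (map (fun _ => [:: a]) s) = nseq (size s) a.
Proof. by elim: s => //= x s ->. Qed.

Lemma catrev_nseq (T : Type) n (a : T) s : catrev (nseq n a) s = nseq n a ++ s.
Proof. by rewrite catrevE rev_nseq. Qed.

Lemma flatten_map_flatten (S T U : Type) (f : T -> seq U) (g : S -> seq T) s :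
  flatten (map f (flatten (map g s))) = flatten [seq flatten (map f (g x)) | x <- s].
Proof. by elim: s => //= x s IH; rewrite map_cat flatten_cat IH. Qed.

Lemma enc_block k i s : map enc_val (block k i s) = nseq (i * k) LS ++ map bit s.
Proof. by rewrite map_cat map_nseq -map_comp. Qed.

Lemma run_scan_to i t j f e s e' : i != t -> i != j -> t != j -> e i = s -> e t = [::] ->
  (forall a, size (f a) <= 1) -> e' = upd e j (catrev (flatten (map f s)) (e j)) ->
  run (scan i t j f) e e' (size s * 5 + 2).
Proof. by move=> h1 h2 h3 <- h4 h5 ->; apply: run_scan. Qed.

Definition cols_cost k c :=
  (k * 5 + 2) * 2 + ((k * (2 ^ k * (c + k * k * 4 + 5) + 2 + (k * 5 + 2)).+1).+1
    + (k * k + k).+1).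

Lemma emits_cols body e k (h : seq (option bool) -> seq letter) c :
  e vK = nseq k L1 -> e vW = [::] -> e vT = [::] -> e vG = [::] -> e vL = [::] ->
  (forall i s x, i < k -> size s = k ->
     emits body (upd (upd e vW (map enc_val (block k i s))) vL x) (h (block k i s)) c) ->
  emits (cols body) e (flatten (map h (block_asgs k))) (cols_cost k c).
Proof.
move=> eK eW eT eG eL hb o.
pose out n := flatten [seq flatten [seq h (block k i s) | s <- bins k] | i <- iota 0 n].
have -> : flatten (map h (block_asgs k)) = out k.
  rewrite flatten_map_flatten /out; congr flatten; apply: eq_map => i.
  by rewrite -map_comp.
have outS n : out n.+1 = out n ++ flatten [seq h (block k n s) | s <- bins k].
  by rewrite /out -[in iota 0 _]addn1 iotaD map_cat flatten_cat /= cats0.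
(* After each block the counter has overflowed to zero, so only [k] more separators have to be put
   on top of it. *)
pose I (d r : seq letter) :=
  upd (upd (upd e vW (nseq (size d * k) LS ++ nseq k L0)) vL r) vO
    (catrev (out (size d)) o).
rewrite /cols_cost mulnDl muln2 -addnn -!addnA.
apply: (@run_le _ _ _ ((k * 5 + 2) + ((k * 5 + 2) +
  ((k * (2 ^ k * (c + k * k * 4 + 5) + 2 + (k * 5 + 2)).+1).+1
    + (k * k + k).+1)))); last by lia.
have hsk : size (nseq k L1) * 5 + 2 = k * 5 + 2 by rewrite size_nseq.
apply: (run_seq (e1 := upd (upd e vO o) vW (nseq k L0))).
  rewrite -hsk; apply: run_scan_to => //.
  by rewrite flatten_map_nseq catrev_nseq /upd /= eW size_nseq cats0.
apply: (run_seq (e1 := I [::] (nseq k L1))).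
  rewrite -hsk; apply: run_scan_to => //.
  by rewrite flatten_map_nseq catrev_nseq /I; env_eq; rewrite eL size_nseq cats0.
apply: (run_seq (e1 := upd (I (nseq k L1) [::]) vL [::])).
  apply: (run_conv (@run_for vL _ (nseq k L1) I
    (2 ^ k * (c + k * k * 4 + 5) + 2 + (k * 5 + 2)) _ _)) => //; last by rewrite size_nseq.
  move=> d a r hd.
  have hdk : size d < k by move/(congr1 size): hd; rewrite size_nseq size_cat /=; lia.
  apply: (run_seq (e1 := upd (upd (upd e vW (nseq (size d * k) LS ++ nseq k L0)) vL r) vO
     (catrev (flatten [seq h (block k (size d) s) | s <- bins k]) (catrev (out (size d)) o)))).
    apply: (run_conv (@emits_bins vW vG vT body
      (upd (upd e vW (nseq (size d * k) LS ++ nseq k L0)) vL r) (size d * k) k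
      (fun s => h (block k (size d) s)) c _ _ _ _ _ _ _ _ _ _ _)) => //.
    - move=> s hs; have := hb (size d) s r hdk hs; rewrite enc_block.
      set e1 := upd _ vL r; set e2 := upd _ vW _.
      suff -> : e1 = e2 by [].
      by rewrite /e1 /e2; env_eq.
    - by rewrite /I; env_eq.
    - by rewrite leq_add2r leq_mul2l; apply/orP; right; nia.
  rewrite -hsk; apply: run_scan_to => //.
  rewrite flatten_map_nseq catrev_nseq /I size_rcons size_nseq mulSn.
  rewrite -catrev_catl -outS.
  by rewrite nseqD -catA; env_eq.
apply: (run_conv (run_clear _ _)) => //.
  by rewrite /I size_nseq; env_eq.
by rewrite /I /upd /= size_cat !size_nseq.
Qed.

(** [LT] occurs only at the end of a clause text, so this yields one [c] per clause, whether the
    text is read forwards or backwards. *)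
Definition sep_bits (c : letter) (a : letter) : seq letter :=
  if a is LT then [:: c] else [::].

Lemma enc_clause_LT cl : all (fun a => a != LT) (enc_clause cl).
Proof.
elim: cl => //= -[s n] cl IH; rewrite /enc_clause /= all_cat -/(enc_clause cl) IH.
by rewrite all_cat all_nseq; case: s; rewrite /= !orbT.
Qed.

Lemma sep_bits_clauses c cls :
  flatten (map (sep_bits c) (enc_clauses cls)) = nseq (size cls) c.
Proof.
elim: cls => //= cl cls IH; rewrite /enc_clauses /= map_cat flatten_cat -/(enc_clauses cls) IH.
rewrite map_cat flatten_cat /=.
suff -> : flatten (map (sep_bits c) (enc_clause cl)) = [::] by [].
by elim: (enc_clause cl) (enc_clause_LT cl) => //= -[] s IH' // /IH'.
Qed.

Lemma size_sep_bits c a : size (sep_bits c a) <= 1. Proof. by case: a. Qed.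

Lemma sep_bits_rev c cls :
  flatten (map (sep_bits c) (rev (enc_clauses cls))) = nseq (size cls) c.
Proof.
rewrite -[RHS]rev_nseq -sep_bits_clauses; elim: (enc_clauses cls) => //= a s IH.
by rewrite rev_cons map_rcons flatten_rcons IH rev_cat; case: a.
Qed.

(** * Writing the rows over one cube vertex *)

Definition enc_row (r : seq bool) : seq letter := map bit r ++ [:: LS].

Definition const_prog (b : bool) : prog :=
  Seq (scan vZ vT vO (fun a => [:: a]))
  (Seq (Push vO (bit b))
  (Seq (scan vF vT vO (sep_bits (bit b)))
  (Seq (cols (Push vO (bit b))) (Push vO LS)))).

(** The singleton columns form a unit vector: a zero for each clause visited, a one, and a zero for
    each clause to come. *)
Definition elem_prog : prog :=
  Seq (scan vZ vT vO (fun a => [:: a]))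
  (Seq (Push vO L0)
  (Seq (scan vE vT vO (sep_bits L0))
  (Seq (Push vO L1)
  (Seq (scan vF vT vO (sep_bits L0))
  (Seq (cols emit_eval) (Push vO LS)))))).

(** [vC] has collected the clause backwards; the first move restores its order for evaluation, the
    second reverses it again, as [vE] requires. *)
Definition clause_prog : prog :=
  Seq (move vC vD) (Seq elem_prog (Seq (move vD vE) (Push vE LT))).

Definition clause_loop : prog :=
  For vF (fun a => match a with LT => clause_prog | _ => Push vC a end).

(** Only the weights 0, 1 and at least 2 have to be distinguished: two pops of the unary weight
    decide, and the rest of it is cleared. *)
Definition row_prog : prog :=
  Seq (scan vZ vT vP (fun a => if a is L1 then [:: L1] else [::]))
  (Seq (Loop vP once (fun x =>
          if x is None then const_prog false
          else Seq (const_prog true)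
                 (Loop vP once (fun x =>
                    if x is None then Skip else Seq clause_loop (move vE vF)))))
       (For vP (fun _ => Skip))).

Section Rows.

Variables (k : nat) (F : seq (seq (bool * nat))) (L : nat).

Local Notation cls := (ext_clauses k F).
Local Notation m := (size cls).
Local Notation asgs := (block_asgs k).
Local Notation q := (m + size asgs).

Hypothesis size_text : size (enc_clauses cls) <= L.

Lemma size_enc_clause_le cl : cl \in cls -> size (enc_clause cl) <= L.
Proof.
move=> h; apply: leq_trans size_text; elim: (cls) h => //= c l IH.
rewrite inE /enc_clauses /= !size_cat => /orP[/eqP<-|/IH]; first lia.
by rewrite /enc_clauses; lia.
Qed.

(** [vP] is left out: the rest of the weight stays on it while the rows are written. *)
Definition temps := [:: vW; vT; vG; vL; vC; vD; vE; vB; vR; vU].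

Definition ready_env (e : env) (z : seq bool) : Prop :=
  [/\ e vK = nseq k L1, e vF = enc_clauses cls, e vZ = map bit z &
      forall i, i \in temps -> e i = [::]].

Definition const_cost (z : seq bool) := size z * 5 + 2 + (1 + (L * 5 + 2 + (cols_cost k 1 + 1))).

Lemma flatten_map_singleton (T : Type) (s : seq T) : flatten (map (fun a => [:: a]) s) = s.
Proof. by elim: s => //= a s ->. Qed.

Lemma emits_const e z b : ready_env e z -> 
  emits (const_prog b) e (enc_row (z ++ nseq q.+1 b)) (const_cost z).
Proof.
case=> eK eF eZ eN.
have -> : enc_row (z ++ nseq q.+1 b) =
  map bit z ++ [:: bit b] ++ nseq m (bit b) ++ nseq (size asgs) (bit b) ++ [:: LS].
  by rewrite /enc_row map_cat map_nseq /= nseqD -!catA /= -!catA.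
apply: emits_seq; last (apply: emits_seq; last (apply: emits_seq; last apply: emits_seq)).
- have := @emits_scan vZ vT (fun a => [:: a]) e isT isT isT (eN vT isT) (fun=> isT).
  by rewrite flatten_map_singleton eZ size_map.
- exact: emits_push.
- have := @emits_scan vF vT _ e isT isT isT (eN vT isT) (size_sep_bits (bit b)).
  rewrite eF sep_bits_clauses => h; apply: emits_le h _.
  by rewrite leq_add2r leq_mul2r size_text orbT.
- rewrite -flatten_map_nseq; apply: emits_cols => //; try exact: eN.
  by move=> i s x _ _; exact: emits_push.
- exact: emits_push.
Qed.

Definition eval_cost := L * (2 * (k * k) + 13) + 10.

Definition elem_cost (z : seq bool) := size z * 5 + 2 + (1 + (L * 5 + 2 + (1 + (L * 5 + 2 +
  (cols_cost k eval_cost + 1))))).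

Lemma mkseq_clause_cov u : u < m ->
  mkseq (fun x => clause_cov k F x u) q =
  nseq u false ++ [:: true] ++ nseq (m - u.+1) false ++
    map (fun w => clause_true w (nth [::] cls u)) asgs.
Proof.
move=> hu; rewrite /mkseq iotaD map_cat add0n !catA; congr (_ ++ _).
  apply: (@eq_from_nth _ false).
    by rewrite size_map size_iota (size_cat _ (nseq _ _)) (size_cat (nseq _ _)) !size_nseq /= addn1 subnKC.
  move=> i; rewrite size_map size_iota => hi.
  rewrite (nth_map 0) ?size_iota // nth_iota // add0n /clause_cov hi.
  rewrite -catA nth_cat size_nseq; case: ltnP => h1; first by rewrite nth_nseq h1; lia.
  case e: (i - u) => [|d] /=; first by lia.
  by rewrite nth_nseq if_same; lia.
rewrite -[m in iota m]addn0 iotaDl -map_comp.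
rewrite -[in RHS](mkseq_nth [::] asgs) /mkseq -map_comp.
by apply: eq_map => i; rewrite /= /clause_cov ltnNge leq_addr addKn.
Qed.

Lemma emits_elem e z d cl r :
  cls = d ++ cl :: r ->
  e vK = nseq k L1 -> e vZ = map bit z -> e vF = enc_clauses r ->
  e vE = rev (enc_clauses d) -> e vD = enc_clause cl ->
  (forall i, i \in [:: vW; vT; vG; vL; vB; vR; vU] -> e i = [::]) ->
  emits elem_prog e (enc_row (elem_row q (clause_cov k F) (size d) z)) (elem_cost z).
Proof.
move=> hcls eK eZ eF eE eD eN.
have hu : size d < m by rewrite hcls size_cat /=; lia.
have hcl : nth [::] cls (size d) = cl by rewrite hcls nth_cat ltnn subnn.
have hS : size (enc_clauses d) <= L /\ size (enc_clauses r) <= L.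
  move: size_text; rewrite hcls /enc_clauses map_cat flatten_cat size_cat /= !size_cat.
  by rewrite -!/(enc_clauses _); lia.
have -> : enc_row (elem_row q (clause_cov k F) (size d) z) =
  map bit z ++ [:: L0] ++ nseq (size d) L0 ++ [:: L1] ++ nseq (size r) L0 ++
  map (fun w => bit (clause_true w cl)) asgs ++ [:: LS].
  rewrite /enc_row /elem_row (mkseq_clause_cov hu) hcl map_cat /= !map_cat /= !map_cat.
  rewrite !map_nseq -map_comp -!catA /= -!catA.
  by have -> : m - (size d).+1 = size r; [rewrite hcls size_cat /=; lia | rewrite /= -!catA].
have sc i c l : i != vT -> i != vO -> e i = enc_clauses l \/ e i = rev (enc_clauses l) ->
    size (enc_clauses l) <= L ->
    emits (scan i vT vO (sep_bits c)) e (nseq (size l) c) (L * 5 + 2).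
  move=> h1 h2 h3 h4.
  have h := @emits_scan i vT _ e h1 h2 isT (eN vT isT) (size_sep_bits c).
  have hsz : size (e i) * 5 + 2 <= L * 5 + 2.
    by rewrite leq_add2r leq_mul2r; case: h3 => ->; rewrite ?size_rev h4 orbT.
  by move: (emits_le h hsz); case: h3 => ->; rewrite ?sep_bits_clauses ?sep_bits_rev.
do ?[apply: emits_seq]; try exact: emits_push.
- have := @emits_scan vZ vT (fun a => [:: a]) e isT isT isT (eN vT isT) (fun=> isT).
  by rewrite flatten_map_singleton eZ size_map.
- by apply: sc => //; [right | case: hS].
- by apply: sc => //; [left | case: hS].
have -> : map (fun w => bit (clause_true w cl)) asgs =
    flatten (map (fun w => [:: bit (clause_true w cl)]) asgs).
  by elim: asgs => //= w l ->.
apply: (@emits_cols emit_eval e k (fun w => [:: bit (clause_true w cl)])) => //; try exact: eN.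
move=> i s x hi hs; apply: emits_le; first apply: emits_eval => //; try exact: eN.
rewrite /eval_cost leq_add2r leq_mul //.
  by apply: size_enc_clause_le; rewrite hcls mem_cat inE eqxx orbT.
by rewrite leq_add2r leq_mul2l size_cat size_nseq size_map hs; nia.
Qed.

Definition clause_cost (z : seq bool) := elem_cost z + 6 * L + 10.

Definition lenv (e : env) f x c : env := upd (upd (upd e vF f) vE x) vC c.

Lemma clause_loop_chars e x f y c o e2 c2 : all (fun a => a != LT) x ->
  run clause_loop (upd (lenv e f y (catrev x c)) vO o) e2 c2 ->
  run clause_loop (upd (lenv e (x ++ f) y c) vO o) e2 (c2 + 2 * size x).
Proof.
elim: x c => [|a x IH] c /=; first by rewrite addn0.
case/andP=> ha hx h; apply: (@run_le _ _ _ (1 + (c2 + 2 * size x)).+1); last by rewrite mulnS addnCA ltn_add2l ltn_add2r.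
apply: (@run_cont _ _ _ _ a (x ++ f)) => //; last exact: IH h.
have -> : match a with LT => clause_prog | _ => Push vC a end = Push vC a.
  by case: a ha {h}.
by apply: run_push; rewrite /lenv; env_eq.
Qed.

Lemma enc_clauses_cat l1 l2 : enc_clauses (l1 ++ l2) = enc_clauses l1 ++ enc_clauses l2.
Proof. by rewrite /enc_clauses map_cat flatten_cat. Qed.

Lemma clause_loop_run e z d r o : ready_env e z -> cls = d ++ r ->
  run clause_loop (upd (lenv e (enc_clauses r) (rev (enc_clauses d)) [::]) vO o)
    (upd (lenv e [::] (rev (enc_clauses cls)) [::]) vO
      (catrev (flatten [seq enc_row (elem_row q (clause_cov k F) u z)
                       | u <- iota (size d) (size r)]) o))
    (size r * clause_cost z + 1).
Proof.
case=> eK eF eZ eN; elim: r d o => [|cl r IH] d o hcls.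
  rewrite cats0 in hcls; apply: (@run_exit _ _ _ _ None [::]) => //.
  by apply: (run_conv (run_skip _)) => //; rewrite /lenv hcls; env_eq.
have hcls' : cls = rcons d cl ++ r by rewrite cat_rcons.
have hin : cl \in cls by rewrite hcls mem_cat inE eqxx orbT.
have hs := size_enc_clause_le hin.
have hrev : rev (enc_clauses (rcons d cl)) =
    LT :: catrev (enc_clause cl) (rev (enc_clauses d)).
  by rewrite -cats1 enc_clauses_cat rev_cat /enc_clauses /= cats0 rev_cat /= catrevE.
have -> : enc_clauses (cl :: r) = enc_clause cl ++ LT :: enc_clauses r.
  by rewrite /enc_clauses /= -catA.
apply: (@run_le _ _ _ ((((size (enc_clause cl) * 2).+1 +
    (elem_cost z + ((size (enc_clause cl) * 2).+1 + 1))) + (size r * clause_cost z + 1)).+1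
    + 2 * size (enc_clause cl))).
  apply: clause_loop_chars; first exact: enc_clause_LT.
  apply: (@run_cont _ _ _ _ LT (enc_clauses r)) => //; last first.
    apply: (run_conv (IH (rcons d cl)
      (catrev (enc_row (elem_row q (clause_cov k F) (size d) z)) o) hcls')) => //.
    by rewrite /= catrev_catl size_rcons.
  pose e1 := upd (lenv e (enc_clauses r) (rev (enc_clauses d)) [::]) vD (enc_clause cl).
  apply: (run_seq (e1 := upd e1 vO o)).
    apply: (run_conv (run_move _ _)) => //.
      rewrite /e1 /lenv; env_eq.
      by rewrite eN // !catrevE !cats0 revK.
    by rewrite /upd /= catrevE cats0 size_rev.
  apply: (run_seq (e1 := upd e1 vO (catrev (enc_row (elem_row q (clause_cov k F) (size d) z)) o))).
    apply: emits_elem hcls _ _ _ _ _ _ _ => //.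
    by move=> i; rewrite !inE; do !case/predU1P => [->|]; try move/eqP->; rewrite /e1 /lenv /upd /=; apply: eN.
  apply: run_seq; first by apply: (run_move _ _).
  apply: run_push; rewrite hrev /e1 /lenv; env_eq.
  by rewrite eN.
rewrite /= mulSn /clause_cost; move: hs; set x := size (enc_clause cl); set y := elem_cost z.
set w := size r * _; move=> hs; lia.
Qed.

Definition rows_cost (z : seq bool) := size z * 5 + 2 +
  ((const_cost z + ((m * clause_cost z + 1) + (L * 2).+1).+1).+1 + (size z).+1).

Lemma emits_row e z : ready_env e z -> e vP = [::] ->
  emits row_prog e (flatten (map enc_row (gadget_rows m q (clause_cov k F) z))) (rows_cost z).
Proof.
move=> he eP o; have [eK eF eZ eN] := he.
have hcnt : count id z <= size z by apply: count_size.
have hr x : ready_env (upd e vP x) z.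
  split=> // i hi; rewrite -(eN i hi); apply: updN.
  by apply: contraTneq hi => ->.
apply: (run_seq (e1 := upd (upd e vO o) vP (nseq (count id z) L1))).
  have -> : size z * 5 + 2 = size (map bit z) * 5 + 2 by rewrite size_map.
  apply: run_scan_to => //; [exact: eN | by case | congr upd].
  rewrite /upd /= eP catrevE cats0.
  have -> : flatten [seq (if a is L1 then [:: L1] else [::]) | a <- map bit z] =
      nseq (count id z) L1 by elim: (z) => //= -[] z' ->.
  by rewrite rev_nseq.
have vPO x o' : upd (upd e vO o') vP x = upd (upd e vP x) vO o' by env_eq.
have fin x o1 : size x <= size z ->
    run (For vP (fun _ => Skip)) (upd (upd e vO o1) vP x) (upd e vO o1) (size z).+1.
  move=> hx; apply: (run_conv (run_clear _ _)) => //.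
  by rewrite -eP; env_eq.
rewrite /gadget_rows /const_row; case hc : (count id z) hcnt => [|n] hcnt.
  have hz : has id z = false by rewrite has_count hc.
  apply: run_seq; last exact: (fin [::]).
  apply: (@run_le _ _ _ (const_cost z).+1); last by lia.
  apply: (@run_exit _ _ _ _ None [::]) => //.
  have h := emits_const false (hr [::]) o; rewrite hz /= cats0.
  by apply: (run_conv h) => //; env_eq.
have hz : has id z by rewrite has_count hc.
have hconst := emits_const true (hr (nseq n L1)) o.
apply: run_seq; last first.
  by apply: (fin (nseq n.-1 L1)); rewrite size_nseq; lia.
apply: (@run_exit _ _ _ _ (Some L1) (nseq n L1)) => //.
apply: (run_seq (e1 := upd (upd e vP (nseq n L1)) vO
    (catrev (enc_row (z ++ nseq q.+1 true)) o))).
  by apply: (run_conv hconst) => //; env_eq.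
case: n {hc fin hconst} hcnt => [|n] hcnt; rewrite hz /=.
  apply: (@run_le _ _ _ 1) => //; apply: (@run_exit _ _ _ _ None [::]) => //.
  by apply: (run_conv (run_skip _)) => //; rewrite /= cats0; env_eq.
apply: (@run_exit _ _ _ _ (Some L1) (nseq n L1)) => //.
have hl := @clause_loop_run _ z [::] cls
   (catrev (enc_row (z ++ nseq q.+1 true)) o) (hr (nseq n L1)) erefl.
apply: (run_seq (run_conv hl _ erefl (leqnn _))).
  by rewrite /lenv; env_eq; rewrite ?eF ?eN.
apply: (run_conv (run_move _ _)) => //.
  rewrite /lenv; env_eq; try by rewrite eN.
    by rewrite catrevE revK cats0 eF.
  by rewrite -map_comp catrev_catl.
by rewrite /lenv /upd /= size_rev; lia.
Qed.

End Rows.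

(* Counts the rounds needed to exhaust [n] when the round that raises the count
   to [j.+1] removes [j.+2]; the final count is about [sqrt (2 * n)]. *)
Fixpoint block_count_rec (fuel j n : nat) : nat :=
  match fuel, n with
  | fuel'.+1, n'.+1 => block_count_rec fuel' j.+1 (n' - j.+1)
  | _, _ => j
  end.

Definition block_count (n : nat) := block_count_rec n 2 n.

(** [j * (j + 3)] is twice [2 + 3 + ... + (j + 1)], the total removed by the rounds up to count [j].
    The last bound is this expression at [r - 1]: one round fewer would not have gone beyond the
    total. *)
Lemma block_count_rec_bounds fuel j n : n <= fuel ->
  let r := block_count_rec fuel j n in
  [/\ j <= r, 2 * n + j * (j + 3) <= r * (r + 3) &
      r.-1 * (r + 2) <= 2 * n + j * (j + 3)].
Proof.
elim: fuel j n => [|f IH] j [|n] //= hn.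
- by split=> //; nia.
- by split=> //; nia.
have [|h1 h2 h3] := IH j.+1 (n - j.+1); first by lia.
have [h|h] := leqP j.+1 n; first by split; nia.
have e : n - j.+1 = 0 by lia.
rewrite e in h1 h2 h3 *.
have -> : block_count_rec f j.+1 0 = j.+1 by case: (f).
by split; nia.
Qed.

(** The count starts at 2, which adds [2 * 5] to [2 * n]. For [k >= 3] one has
    [k * (k + 3) <= 2 * (k * k)], and [k = 2] occurs only for [n = 0]. The 12 is [10 + 2], from
    [(k - 1) * (k + 2) = k * k + k - 2]. *)
Lemma block_count_spec n : [/\ 1 < block_count n, n <= block_count n * block_count n &
   block_count n * block_count n <= 2 * n + 12].
Proof.
have [h1 h2 h3] := block_count_rec_bounds 2 (leqnn n).
by rewrite /block_count; move: (block_count_rec n 2 n) h1 h2 h3 => r h1 h2 h3; split; nia.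
Qed.

(** * Preparing the stacks: parsing, number of blocks, tautologies *)

Definition read_unary : prog :=
  Loop vF (fun x => if x is Some L1 then true else false)
    (fun x => if x is Some L1 then Push vN L1 else Skip).

Definition count_blocks : prog :=
  For vN (fun _ => Seq (Push vK L1)
    (Seq (For vK (fun a => Seq (Push vT a) (Loop vN once (fun _ => Skip)))) (move vT vK))).

(** The text is pushed from its terminator backwards; the last push advances the variable index,
    kept in unary on [vX]. *)
Definition push_taut : prog :=
  Seq (Push vF LT) (Seq (Push vF LS) (Seq (scan vX vT vF (fun _ => [:: L1]))
  (Seq (Push vF L0) (Seq (Push vF LS) (Seq (scan vX vT vF (fun _ => [:: L1]))
  (Seq (Push vF L1) (Push vX L1))))))).

Definition push_tauts : prog :=
  Seq (scan vK vT vL (fun _ => [:: L1]))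
  (Seq (For vL (fun _ => Seq (scan vK vT vV (fun _ => [:: L1])) (For vV (fun _ => push_taut))))
       (For vX (fun _ => Skip))).

(** The last input letter is on top of stack 0, so the text is first turned round. Two ones on [vK]
    start the block count at 2, and the final [L0] supplies the extra cube coordinate. *)
Definition prepare : prog :=
  Seq (move 0 vF) (Seq read_unary (Seq (Seq (Push vK L1) (Push vK L1))
  (Seq count_blocks (Seq push_tauts (Seq (scan vK vT vZ (fun _ => [:: L0])) (Push vZ L0)))))).

Definition reduction : prog :=
  Seq prepare (Seq (bins_loop vZ vH vT row_prog)
    (Seq (Push vO LT) (scan vK vT vO (fun _ => [:: L1])))).

Definition env0 : env := fun _ => [::].

Lemma read_unary_run n f x :
  run read_unary (upd (upd env0 vF (nseq n L1 ++ LT :: f)) vN (nseq x L1))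
    (upd (upd env0 vF f) vN (nseq (n + x) L1)) (n * 2 + 1).
Proof.
elim: n x => [|n IH] x.
  apply: (@run_exit _ _ _ _ (Some LT) f) => //.
  by apply: (run_conv (run_skip _)) => //; env_eq.
apply: (@run_le _ _ _ (1 + (n * 2 + 1)).+1); last by lia.
apply: (@run_cont _ _ _ _ L1 (nseq n L1 ++ LT :: f)) => //; last first.
  by apply: (run_conv (IH x.+1)) => //; rewrite addnS.
by apply: run_push; env_eq.
Qed.

Definition cenv f j n := upd (upd (upd env0 vF f) vK (nseq j L1)) vN (nseq n L1).

Lemma drop_round f j n :
  run (Seq (For vK (fun a => Seq (Push vT a) (Loop vN once (fun _ => Skip)))) (move vT vK))
    (cenv f j n) (cenv f j (n - j)) (6 * j + 2).
Proof.
pose I (d r : seq letter) :=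
  upd (upd (upd (upd env0 vF f) vK r) vT (rev d)) vN (nseq (n - size d) L1).
apply: (@run_le _ _ _ ((j * 3).+1 + (j * 2).+1)); last by lia.
apply: (run_seq (e1 := upd (I (nseq j L1) [::]) vK [::])).
  apply: (run_conv (@run_for vK _ (nseq j L1) I 2 _ _)) => //.
  - move=> d a r _; apply: (run_seq (c1 := 1) (c2 := 1)); first by apply: run_push; reflexivity.
    rewrite /I size_rcons rev_rcons subnS; case e: (n - size d) => [|y] /=.
      apply: (@run_exit _ _ _ _ None [::]) => //.
      by apply: (run_conv (run_skip _)) => //; env_eq.
    apply: (@run_exit _ _ _ _ (Some L1) (nseq y L1)) => //.
    by apply: (run_conv (run_skip _)) => //; env_eq.
  - by rewrite /I /cenv /= subn0; env_eq.
  - by rewrite size_nseq.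
apply: (run_conv (run_move _ _)) => //.
  rewrite /I /cenv size_nseq; env_eq.
  by rewrite catrevE revK cats0.
by rewrite /I /upd /= size_rev size_nseq.
Qed.

Lemma count_blocks_run f fuel j n : n <= fuel ->
  run count_blocks (cenv f j n) (cenv f (block_count_rec fuel j n) 0)
   ((block_count_rec fuel j n - j) * (6 * block_count_rec fuel j n + 10) + 1).
Proof.
elim: fuel j n => [|fu IH] j [|n] // hn.
- apply: (@run_le _ _ _ 1); last by rewrite addn1.
  apply: (@run_exit _ _ _ _ None [::]) => //.
  by apply: (run_conv (run_skip _)) => //; rewrite /cenv; env_eq.
- apply: (@run_le _ _ _ 1); last by rewrite addn1.
  apply: (@run_exit _ _ _ _ None [::]) => //.
  by apply: (run_conv (run_skip _)) => //; rewrite /cenv; env_eq.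
have hn' : n - j.+1 <= fu by lia.
have [h1 _ _] := block_count_rec_bounds j.+1 hn'.
rewrite -[block_count_rec fu.+1 j n.+1]/(block_count_rec fu j.+1 (n - j.+1)).
move: (IH j.+1 (n - j.+1) hn'); move: (block_count_rec fu j.+1 (n - j.+1)) h1 => r h1 hr.
apply: (@run_le _ _ _ ((1 + (6 * j.+1 + 2)) + ((r - j.+1) * (6 * r + 10) + 1)).+1); last by nia.
apply: (@run_cont _ _ _ _ L1 (nseq n L1)) => //; last exact: hr.
apply: run_seq; first by apply: run_push; reflexivity.
by apply: (run_conv (drop_round f j.+1 n)) => //; rewrite /cenv; env_eq.
Qed.

Section Tauts.

Variable text : seq letter.

Definition tenv (e : env) x := upd (upd e vX (nseq x L1)) vF
  (enc_clauses [seq taut y | y <- rev (iota 0 x)] ++ text).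

Lemma taut_run e x : e vT = [::] -> run push_taut (tenv e x) (tenv e x.+1) (x * 10 + 10).
Proof.
move=> eT; have hx : size (nseq x L1) * 5 + 2 = x * 5 + 2 by rewrite size_nseq.
apply: (@run_le _ _ _ (1 + (1 + ((x * 5 + 2) + (1 + (1 + ((x * 5 + 2) + (1 + 1))))))));
  last by lia.
do 2 (apply: run_seq; first by apply: run_push; reflexivity).
apply: run_seq; first by rewrite -hx; apply: run_scan_to => //; reflexivity.
do 2 (apply: run_seq; first by apply: run_push; reflexivity).
apply: run_seq; first by rewrite -hx; apply: run_scan_to => //; reflexivity.
apply: run_seq; first by apply: run_push; reflexivity.
have rS : rev (iota 0 x.+1) = x :: rev (iota 0 x).
  by rewrite -addn1 iotaD rev_cat.
apply: run_push; rewrite /tenv rS !flatten_map_nseq !catrev_nseq; env_eq.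
rewrite /enc_clauses /= -/(enc_clauses _).
by rewrite size_nseq /enc_clause /= /enc_lit /= -!catA /= -!catA /=.
Qed.

Lemma tauts_run e k : e vT = [::] -> e vL = [::] -> e vV = [::] -> e vX = [::] ->
  e vF = text -> e vK = nseq k L1 ->
  run push_tauts e (upd e vF (enc_clauses [seq taut y | y <- rev (iota 0 (k * k))] ++ text))
    (k * 5 + 2 + ((k * (k * 5 + 2 + (k * (k * k * 10 + 10).+1).+1).+1).+1 + (k * k).+1)).
Proof.
move=> eT eL eV eX eF eK; have hk : size (nseq k L1) * 5 + 2 = k * 5 + 2 by rewrite size_nseq.
pose I (d r : seq letter) := upd (tenv e (size d * k)) vL r.
apply: (run_seq (e1 := I [::] (nseq k L1))).
  rewrite -hk; apply: run_scan_to => //.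
  rewrite flatten_map_nseq catrev_nseq /I /tenv size_nseq /=; env_eq.
  by rewrite eL cats0.
apply: (run_seq (e1 := upd (I (nseq k L1) [::]) vL [::])).
  apply: (run_conv (@run_for vL _ (nseq k L1) I
    (k * 5 + 2 + (k * (k * k * 10 + 10).+1).+1) _ _)) => //; last by rewrite size_nseq.
  move=> d a r hd.
  have hdk : size d < k by move/(congr1 size): hd; rewrite size_nseq size_cat /=; lia.
  pose J (d' r' : seq letter) := upd (upd (tenv e (size d * k + size d')) vL r) vV r'.
  apply: (run_seq (e1 := J [::] (nseq k L1))).
    rewrite -hk; apply: run_scan_to => //.
    rewrite flatten_map_nseq catrev_nseq /I /J /tenv size_nseq /= addn0; env_eq.
    by rewrite eV cats0.
  apply: (run_conv (@run_for vV _ (nseq k L1) J (k * k * 10 + 10) _ _)) => //; last first.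
    by rewrite size_nseq.
    rewrite /J /I size_nseq size_rcons mulSn addnC /tenv; env_eq.
  move=> d' a' r' hd'.
  have hdk' : size d' < k by move/(congr1 size): hd'; rewrite size_nseq size_cat /=; lia.
  have ht : upd (upd e vL r) vV r' vT = [::] by [].
  apply: (@run_le _ _ _ ((size d * k + size d') * 10 + 10)); last by nia.
  apply: (run_conv (taut_run (size d * k + size d') ht)) => //.
    by rewrite /J /tenv; env_eq.
  by rewrite /J size_rcons addnS /tenv; env_eq.
apply: (run_conv (run_clear _ _)) => //.
  by rewrite /I /tenv size_nseq; env_eq.
by rewrite /I /tenv /upd /= !size_nseq.
Qed.

End Tauts.

Definition penv k F : env := upd (upd (upd env0 vK (nseq k L1))
  vF (enc_clauses (ext_clauses k F))) vZ (nseq k.+1 L0).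

Lemma ext_text k F : enc_clauses (ext_clauses k F) =
  enc_clauses [seq taut y | y <- rev (iota 0 (k * k))] ++ enc_clauses F.
Proof. exact: enc_clauses_cat. Qed.

Lemma enc_cnfE N cls : enc_cnf (N, cls) = nseq N L1 ++ LT :: enc_clauses cls.
Proof. by []. Qed.

Definition prepare_cost N k s := (N + s.+1) * 2 + 1 + (N * 2 + 1 + (2 +
  (k * (6 * k + 10) + 1 + (k * 5 + 2 + ((k * (k * 5 + 2 + (k * (k * k * 10 + 10).+1).+1).+1).+1
    + (k * k).+1) + (k * 5 + 2 + 1))))).

Lemma prepare_run N cls : let k := block_count N in
  run prepare (input_env (enc_cnf (N, cls))) (penv k cls)
    (prepare_cost N k (size (enc_clauses cls))).
Proof.
move=> k; set f := enc_clauses cls.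
apply: run_seq.
  apply: (run_conv (@run_move 0 vF _ isT)) => //.
  by rewrite /input_env eqxx size_rev enc_cnfE size_cat size_nseq /= addn1.
have -> : upd (upd (input_env (enc_cnf (N, cls))) 0 [::]) vF
    (catrev (input_env (enc_cnf (N, cls)) 0) (input_env (enc_cnf (N, cls)) vF)) =
  upd (upd env0 vF (nseq N L1 ++ LT :: f)) vN (nseq 0 L1).
  by rewrite /env0 /input_env /=; env_eq; rewrite catrevE revK cats0.
apply: run_seq; first exact: read_unary_run.
apply: (run_seq (e1 := cenv f 2 N)).
  apply: (run_seq (c1 := 1) (c2 := 1)); first by apply: run_push; reflexivity.
  by apply: run_push; rewrite /cenv addn0; env_eq.
apply: run_seq.
  apply: (run_conv (@count_blocks_run f N 2 N _)) => //.
  by rewrite leq_add2r leq_mul2r leq_subr orbT.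
apply: run_seq.
  by apply: (@tauts_run f _ k).
have hk : size (nseq k L1) * 5 + 2 = k * 5 + 2 by rewrite size_nseq.
apply: run_seq; first by rewrite -hk; apply: run_scan_to => //; reflexivity.
apply: run_push; rewrite flatten_map_nseq catrev_nseq /penv ext_text /cenv size_nseq; env_eq.
by rewrite cats0.
Qed.

Definition reduction_cost N k F :=
  let L := size (enc_clauses (ext_clauses k F)) in
  prepare_cost N k (size (enc_clauses F)) +
  (2 ^ k.+1 * (rows_cost k F L (nseq k.+1 false) + (0 + k.+1) * 4 + 5) + 2 + (1 + (k * 5 + 2))).

Definition reduced (F : cnf) : rtd_inst :=
  let k := block_count F.1 in
  let m := size (ext_clauses k F.2) in
  (gadget k m (m + size (block_asgs k)) (clause_cov k F.2), k).

Lemma reduction_run (F : cnf) : let k := block_count F.1 in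
  let cls := ext_clauses k F.2 in
  exists2 e, e vO = rev (enc_rtd (reduced F)) &
  run reduction (input_env (enc_cnf F)) e
    (reduction_cost F.1 k F.2).
Proof.
case: F => N F /=; set k := block_count N; set cls := ext_clauses k F.
set L := size (enc_clauses cls).
pose w := flatten (map enc_row (gadget k (size cls) (size cls + size (block_asgs k)) (clause_cov k F))).
exists (upd (penv k F) vO (catrev (w ++ [:: LT] ++ nseq k L1) [::])).
  by rewrite updE catrevE cats0.
apply: run_seq; first exact: prepare_run.
suff h : emits (Seq (bins_loop vZ vH vT row_prog)
    (Seq (Push vO LT) (scan vK vT vO (fun _ => [:: L1])))) (penv k F) (w ++ [:: LT] ++ nseq k L1)
    (2 ^ k.+1 * (rows_cost k F L (nseq k.+1 false) + (0 + k.+1) * 4 + 5) + 2 + (1 + (k * 5 + 2))).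
  by apply: (run_conv (h [::])) => //; env_eq.
apply: emits_seq.
  rewrite /w /gadget flatten_map_flatten.
  apply: (@emits_bins vZ vH vT row_prog _ 0 k.+1 _ (rows_cost k F L (nseq k.+1 false))) => //.
  move=> s hs.
  have -> : rows_cost k F L (nseq k.+1 false) = rows_cost k F L s.
    by rewrite /rows_cost /const_cost /clause_cost /elem_cost size_nseq hs.
  apply: emits_row => //; split=> // i hi.
  by move: hi; rewrite !inE; do !case/predU1P => [->|] //; move/eqP->.
apply: emits_seq; first exact: emits_push.
have := @emits_scan vK vT (fun _ => [:: L1]) (penv k F) isT isT isT erefl (fun=> isT).
by rewrite flatten_map_nseq size_nseq.
Qed.

(** * Subexponential time *)

(** 19 is [vX], the largest stack index. *)
Lemma reduction_ok : prog_ok 19 reduction.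
Proof. by vm_compute. Qed.

(** * Sizes and running times in terms of the number of variables *)

Definition all_lits N : seq (bool * nat) := [seq (b, x) | b <- [:: true; false], x <- iota 0 N].

Fixpoint all_clauses N d : seq (seq (bool * nat)) :=
  if d is d'.+1
  then [::] :: [seq l :: c | l <- all_lits N, c <- all_clauses N d'] else [:: [::]].

Lemma mem_all_clauses N d cl : size cl <= d -> all (fun l => l.2 < N) cl ->
  cl \in all_clauses N d.
Proof.
elim: d cl => [|d IH] [|[b x] cl] //= hs /andP[hl hc].
rewrite inE /=; apply/allpairsP; exists ((b, x), cl); split=> //=; last exact: IH.
by apply/allpairsP; exists (b, x); split=> //; [case: b | rewrite mem_iota].
Qed.

Lemma size_all_clauses N d : size (all_clauses N d) <= (2 * N + 1) ^ d.
Proof.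
elim: d => //= d IH; rewrite size_allpairs size_allpairs size_iota /= expnS.
have := expn_gt0 (2 * N + 1) d; nia.
Qed.

(** Because the clauses are distinct, the whole formula is polynomial in the number of variables,
    which is what allows time to be measured by that number alone. *)
Lemma size_clauses F : wf_cnf F -> size F.2 <= (2 * F.1 + 1) ^ 3.
Proof.
case=> hu /allP ha; apply: leq_trans (size_all_clauses F.1 3).
apply: uniq_leq_size => // cl /ha /andP[h1 h2]; exact: mem_all_clauses.
Qed.

Lemma size_enc_clauses_le cls s :
  all (fun cl => size (enc_clause cl) < s) cls -> size (enc_clauses cls) <= size cls * s.
Proof.
elim: cls => //= cl cls IH /andP[h1 /IH h2].
by rewrite /enc_clauses /= size_cat -/(enc_clauses cls) size_cat /= addn1 mulSn leq_add.
Qed.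

Lemma size_enc_clause_lits cl N : all (fun l : bool * nat => l.2 < N) cl ->
  size (enc_clause cl) <= size cl * N.+1.
Proof.
elim: cl => //= -[b x] cl IH /= /andP[h1 /IH h2].
rewrite /enc_clause /= size_cat -/(enc_clause cl) size_cat size_nseq /=; lia.
Qed.

Section SizeBounds.

Variable F : cnf.
Hypothesis wfF : wf_cnf F.
Local Notation k := (block_count F.1).
Local Notation cls := (ext_clauses k F.2).

Lemma F_vars_blocks : all (all (fun l => l.2 < k * k)) F.2.
Proof.
have [_ hN _] := block_count_spec F.1; have [_ /allP ha] := wfF.
apply/allP => cl /ha /andP[_ /allP hl]; apply/allP => l /hl /=; lia.
Qed.

(** [27 = 3 ^ 3] comes from [2 * N + 1 <= 3 * X]; a clause takes at most [3 * N + 4 <= 4 * X]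
    letters, whence 108; the tautologies add at most [4 * X ^ 4]. *)
Lemma text_sizes : let X := k * k in
  [/\ size (enc_clauses F.2) <= 108 * X ^ 4, size (enc_clauses cls) <= 112 * X ^ 4
    & size cls <= 28 * X ^ 3].
Proof.
have [hk hN _] := block_count_spec F.1; set X := k * k in hN *.
have hX : 4 <= X by rewrite /X; nia.
have h1 := size_clauses wfF.
have h2 : size F.2 <= 27 * X ^ 3.
  apply: leq_trans h1 _; rewrite (_ : 27 = 3 ^ 3) // -expnMn leq_exp2r //; lia.
have h3 : size (enc_clauses F.2) <= size F.2 * (3 * X + 4).
  apply: size_enc_clauses_le; have [_ /allP ha] := wfF.
  apply/allP => cl /ha /andP[hs hl] /=; have := size_enc_clause_lits hl; nia.
have h4 : size (enc_clauses F.2) <= 108 * X ^ 4.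
  apply: leq_trans h3 _; rewrite expnS; move: (X ^ 3) h2 => Y h2; nia.
have hT : size (enc_clauses [seq taut x | x <- rev (iota 0 X)]) <= X * (2 * X + 3).
  have {2}<- : size [seq taut x | x <- rev (iota 0 X)] = X.
    by rewrite size_map size_rev size_iota.
  apply: size_enc_clauses_le; apply/allP => _ /mapP[x + ->].
  rewrite mem_rev mem_iota add0n => /andP[_ hx].
  have := @size_enc_clause_lits (taut x) X; rewrite /= hx => /(_ isT); lia.
split=> //.
  rewrite ext_text size_cat -/X; apply: (@leq_trans (X * (2 * X + 3) + 108 * X ^ 4)).
    exact: leq_add.
  rewrite -[112]/(4 + 108) mulnDl leq_add2r (_ : X ^ 4 = X * X * (X * X)); last by rewrite !expnS; nia.
  nia.
rewrite size_cat size_map size_rev size_iota -/X.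
apply: (@leq_trans (X + 27 * X ^ 3)); first by rewrite leq_add2l.
rewrite -[28]/(1 + 27) mulnDl leq_add2r mul1n -{1}[X]expn1 leq_pexp2l //; lia.
Qed.

Lemma size_block_asgs : size (block_asgs k) = k * 2 ^ k.
Proof.
rewrite size_flatten /shape -map_comp.
rewrite (eq_map (g := fun _ => 2 ^ k)); last by move=> i; rewrite /= size_map size_bins.
have H (s : seq nat) : sumn [seq 2 ^ k | _ <- s] = size s * 2 ^ k.
  by elim: s => //= i l ->; rewrite mulSn.
by rewrite H size_iota.
Qed.

(** The unit of all estimates: [112 * k ^ 8 <= 2 ^ 7 * 2 ^ (8 * k) <= 2 ^ (12 * k)], as [k >= 2].
    Passing to the next power gains a factor 100, which absorbs constants and lower terms. *)
Definition bnd := 2 ^ (12 * k).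

Lemma bnd_ge : [/\ 100 <= bnd, k * k + k <= bnd, 2 ^ k.+1 <= bnd, F.1 <= bnd
   & [/\ size (enc_clauses F.2) <= bnd, size (enc_clauses cls) <= bnd
       & size cls <= bnd]].
Proof.
have [hk hN _] := block_count_spec F.1.
have [h1 h2 h3] := text_sizes.
have hk2 : k <= 2 ^ k by rewrite ltnW // ltn_expl.
have hX : k * k <= 2 ^ (2 * k) by rewrite mulnC expnM -mulnn leq_sqr.
have hX4 : (k * k) ^ 4 <= 2 ^ (8 * k).
  by rewrite (_ : 8 * k = 2 * k * 4) ?[2 ^ (_ * 4)]expnM ?leq_exp2r //; lia.
have hX3 : (k * k) ^ 3 <= 2 ^ (8 * k).
  by apply: leq_trans hX4; rewrite leq_pexp2l //; nia.
have h128 : 128 * 2 ^ (8 * k) <= bnd.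
  rewrite (_ : 128 = 2 ^ 7) // -expnD /bnd leq_pexp2l //; lia.
have h8 : 2 ^ (2 * k) <= 2 ^ (8 * k) by rewrite leq_pexp2l //; lia.
have h1' : 2 ^ k <= 2 ^ (2 * k) by rewrite leq_pexp2l //; lia.
have hp : 0 < 2 ^ (8 * k) by rewrite expn_gt0.
rewrite expnS.
move: (2 ^ (8 * k)) (2 ^ (2 * k)) (2 ^ k) bnd ((k * k) ^ 4) ((k * k) ^ 3)
  hk2 hX hX4 hX3 h128 h8 h1' hp h1 h2 h3 => a b c d u v *; split; [lia|lia|lia|lia|split; lia].
Qed.

Lemma pow_step j : 100 * bnd ^ j <= bnd ^ j.+1.
Proof. by rewrite expnS leq_mul2r; case: bnd_ge => -> *; rewrite orbT. Qed.

Lemma pow_pos j : 0 < bnd ^ j.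
Proof. by rewrite !expn_gt0. Qed.

Lemma cols_cost_le c j : c <= bnd ^ j.+2 -> cols_cost k c <= bnd ^ (j + 5).
Proof.
move=> hc; have [hB hkk hP _ _] := bnd_ge.
have hP' : 2 ^ k <= bnd by apply: leq_trans hP; rewrite leq_pexp2l.
have e1 : bnd ^ (j + 3) = bnd * bnd ^ j.+2 by rewrite -expnS addn3.
have e2 : bnd ^ (j + 4) = bnd * bnd ^ (j + 3) by rewrite -expnS addnS.
have e3 : bnd ^ (j + 5) = bnd * bnd ^ (j + 4) by rewrite -expnS addnS.
have hb : bnd * 100 <= bnd ^ j.+2.
  apply: (@leq_trans (bnd ^ 2)); last by rewrite leq_pexp2l //; lia.
  by rewrite expnS expn1 leq_mul2l hB orbT.
rewrite /cols_cost; move: (2 ^ k) hP' => P hP'.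
move: (bnd ^ j.+2) hc e1 hb => Y hc e1 hb.
have s1 : P * (c + k * k * 4 + 5) <= bnd * (2 * Y) by apply: leq_mul => //; lia.
have s2 : k * (P * (c + k * k * 4 + 5) + 2 + (k * 5 + 2)).+1 <= bnd * (bnd * (3 * Y)).
  apply: leq_mul; first by lia.
  apply: (@leq_trans (bnd * (2 * Y) + 100 * bnd)); first by lia.
  have : 100 * bnd <= bnd * Y by rewrite mulnC leq_mul2l; apply/orP; right; lia.
  nia.
rewrite e3 e2 e1; apply: (@leq_trans (bnd * (bnd * (4 * Y)))); last first.
  rewrite !leq_mul2l; apply/orP; right; apply/orP; right.
  by rewrite leq_mul2r; apply/orP; right; lia.
have : 100 * bnd <= bnd * (bnd * Y).
  by rewrite mulnC leq_mul2l; apply/orP; right; nia.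
nia.
Qed.

Lemma reduction_cost_le : reduction_cost F.1 k F.2 <= bnd ^ 13.
Proof.
have [hB hkk hP hN [hs hL hm]] := bnd_ge; have [hk _ _] := block_count_spec F.1.
rewrite /reduction_cost; set z := nseq _ _; set L := size (enc_clauses cls) in hL *.
have hz : size z = k.+1 by rewrite size_nseq.
have b1 : bnd ^ 1 = bnd by rewrite expn1.
have p1 := pow_step 1; have p2 := pow_step 2; have p3 := pow_step 3; have p4 := pow_step 4.
have p5 := pow_step 5; have p6 := pow_step 6; have p7 := pow_step 7; have p8 := pow_step 8.
have p9 := pow_step 9; have p10 := pow_step 10; have p11 := pow_step 11; have p12 := pow_step 12.
have m2 : bnd ^ 2 = bnd * bnd by rewrite -mulnn.
have mS j : bnd * bnd ^ j = bnd ^ j.+1 by rewrite expnS.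
have c1 : cols_cost k 1 <= bnd ^ 5 by apply: (@cols_cost_le _ 0); apply: pow_pos.
have hev : eval_cost k L <= bnd ^ 3.
  rewrite /eval_cost; apply: (@leq_trans (bnd * (2 * bnd + 13) + 10)).
    by rewrite leq_add2r leq_mul //; lia.
  nia.
have c2 : cols_cost k (eval_cost k L) <= bnd ^ 6 by apply: (@cols_cost_le _ 1).
have hc : const_cost k L z <= bnd ^ 6 by rewrite /const_cost hz; lia.
have he : elem_cost k L z <= bnd ^ 7 by rewrite /elem_cost hz; lia.
have hcl : clause_cost k L z <= bnd ^ 8 by rewrite /clause_cost; lia.
have hmc : size cls * clause_cost k L z <= bnd ^ 9 by rewrite -mS leq_mul.
have hr : rows_cost k F.2 L z <= bnd ^ 10 by rewrite /rows_cost hz; lia.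
have hbins : 2 ^ k.+1 * (rows_cost k F.2 L z + (0 + k.+1) * 4 + 5) <= bnd ^ 12.
  by rewrite -mS leq_mul //; lia.
have hprep : prepare_cost F.1 k (size (enc_clauses F.2)) <= bnd ^ 4.
  rewrite /prepare_cost.
  have q1 : k * (6 * k + 10) <= 16 * bnd by nia.
  have q2 : k * (k * k * 10 + 10).+1 <= bnd * (21 * bnd) by apply: leq_mul; lia.
  have q3 : k * (k * 5 + 2 + (k * (k * k * 10 + 10).+1).+1).+1 <= bnd * (22 * bnd ^ 2).
    by apply: leq_mul; [lia | rewrite m2 in p1 *; nia].
  have q4 : bnd * (22 * bnd ^ 2) = 22 * bnd ^ 3 by rewrite mulnCA -expnS.
  lia.
lia.
Qed.

Lemma size_enc_cnf_le : size (enc_cnf F) <= bnd ^ 2.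
Proof.
have [hB _ _ hN [hs _ _]] := bnd_ge.
have p1 := pow_step 1; rewrite expn1 in p1.
case: F hN hs p1 => N G /= hN hs p1; rewrite enc_cnfE size_cat size_nseq /=; lia.
Qed.

Lemma ncols_reduced : let q := size cls + size (block_asgs k) in
  ncols (reduced F).1 = k.+2 + q.
Proof.
move=> q; rewrite /ncols /reduced /=.
have := @gadget_neq0 k (size cls) q (clause_cov k F.2).
case h: gadget => [|r l] // _ /=; rewrite -/q.
by apply: (@size_gadget_row k (size cls) q (clause_cov k F.2)); rewrite h inE eqxx.
Qed.

Lemma size_reduced : rtd_size (reduced F) <= bnd ^ 5.
Proof.
have [hB hkk hP hN [hs hL hm]] := bnd_ge; have [hk _ _] := block_count_spec F.1.
rewrite /rtd_size ncols_reduced size_block_asgs.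
have h1 := @size_gadget k (size cls) (size cls + k * 2 ^ k) (clause_cov k F.2).
have hP' : 2 ^ k <= bnd by apply: leq_trans hP; rewrite leq_pexp2l.
have m2 : bnd ^ 2 = bnd * bnd by rewrite -mulnn.
rewrite /= size_block_asgs (_ : 5 = 3 + 2) // expnD; apply: leq_mul.
  apply: leq_trans h1 _; rewrite [bnd ^ 3]expnS; apply: leq_mul => //.
  by rewrite m2; nia.
rewrite m2; have : k * 2 ^ k <= k * bnd by rewrite leq_mul2l hP' orbT.
nia.
Qed.

Lemma reduced_valid : valid_rtd (reduced F).
Proof.
have [hk _ _] := block_count_spec F.1; split.
  apply: uniq_gadget; first exact: m_large hk F_vars_blocks.
  exact: clause_cov_single hk F_vars_blocks.
rewrite ncols_reduced; apply/allP => r hr; apply/eqP; exact: size_gadget_row hr.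
Qed.

Lemma reduced_yes : rtd_yes (reduced F) <-> sat F.
Proof.
have [hk _ _] := block_count_spec F.1.
rewrite /rtd_yes ncols_reduced.
have -> : sat F <-> exists P, is_cover k (size cls) (size cls + size (block_asgs k))
   (clause_cov k F.2) P by rewrite (cover_sat hk F_vars_blocks).
apply: RTD_gadget; first exact: m_large hk F_vars_blocks.
- exact: clause_cov_single hk F_vars_blocks.
- exact: clause_cov_miss hk F_vars_blocks.
Qed.

End SizeBounds.

(** [360 = 12 * 30] and [60 = 12 * 5]: time and matrix size are at most [bnd ^ 30] and [bnd ^ 5].
    The maximum is taken because [f] may fail to be monotone. *)
Definition sat_time (f : nat -> nat) (N : nat) : nat :=
  2 ^ (360 * block_count N) + \max_(n < (2 ^ (60 * block_count N)).+1) f n.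

Lemma simulation_time b t s : 100 <= b -> t <= b ^ 13 -> s <= b ^ 2 ->
  t * (2 * (s + t) + 4) + 2 <= b ^ 30.
Proof.
move=> hb ht hs; have b0 : 0 < b by lia.
have h2 : b ^ 2 <= b ^ 13 by rewrite leq_pexp2l.
have h1 : 0 < b ^ 13 by rewrite expn_gt0 b0.
have h14 : 100 * b ^ 13 <= b ^ 14 by rewrite (expnS b 13) leq_mul2r hb orbT.
have h28 : 100 * b ^ 27 <= b ^ 28 by rewrite (expnS b 27) leq_mul2r hb orbT.
have h30 : b ^ 28 <= b ^ 30 by rewrite leq_pexp2l.
have p27 : 0 < b ^ 27 by rewrite expn_gt0 b0.
have e27 : b ^ 13 * b ^ 14 = b ^ 27 by rewrite -expnD.
move: (b ^ 13) (b ^ 2) (b ^ 14) (b ^ 27) (b ^ 28) (b ^ 30) ht hs h2 h1 h14 h28 h30 p27 e27.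
move=> x y z u v w ht hs h2 h1 h14 h28 h30 p27 e27.
have h : t * (2 * (s + t) + 4) <= x * z by apply: leq_mul => //; lia.
lia.
Qed.

Lemma decides_sat M f : decides_within M f valid_rtd enc_rtd rtd_size rtd_yes ->
  decides_within (run_before M reduction 19 vO) (sat_time f) wf_cnf enc_cnf nvars sat.
Proof.
move=> hM F wfF; set k := block_count F.1.
have [b [hb hbP]] := hM (reduced F) (reduced_valid wfF).
exists b; split; last by rewrite hbP reduced_yes.
have [e he [t ht hex]] := reduction_run F.
have := @run_before_out M reduction 19 vO _ (enc_rtd (reduced F)) e t _ b
  reduction_ok isT hex he hb.
apply: out_within_mono; apply: leq_add.
  have {}ht : t <= bnd F ^ 13 := leq_trans ht (reduction_cost_le wfF).
  have -> : 2 ^ (360 * k) = bnd F ^ 30.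
    by rewrite -expnM mulnAC.
  have [hB _ _ _ _] := bnd_ge wfF.
  exact: simulation_time hB ht (size_enc_cnf_le wfF).
have hsz : rtd_size (reduced F) < (2 ^ (60 * k)).+1.
  have -> : 2 ^ (60 * k) = bnd F ^ 5 by rewrite -expnM mulnAC.
  by rewrite ltnS; apply: size_reduced.
exact: (leq_bigmax (Ordinal hsz)).
Qed.

(** As [k * k = O(N)], the first summand has exponent [O(sqrt N)], and [f] at sizes [2 ^ O(k)] is
    [2 ^ o(k * k)]. The sum is at most twice its larger term, so both terms are estimated with a
    factor 2. *)
Lemma sat_time_subexp f : quasi_sub f -> subexp (sat_time f).
Proof.
move=> hf c hc; have [D [hD0 hD]] : exists D, 0 < D /\ 60 * 60 * 4 = D.
  by eexists; split; last reflexivity.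
(* [D] makes up for [(60 * k) ^ 2 <= D * N], and the 2 for the factor in [2 * M]. *)
have [|N1 hN1] := hf (2 * c * D); first by rewrite !muln_gt0 hc hD0.
(* Sizes below [N1] escape the asymptotic bound and are handled by the constant [M1]. From [K] on,
   [8 * 360 * c * k <= k * k]. *)
pose M1 := \max_(n < N1) f n; pose K := 8 * 360 * c.
exists (2 * c * M1 + 2 * c + 2 * 360 * c * K + 12) => N hN.
have [hk _ hk2] := block_count_spec N; rewrite /sat_time.
move: (block_count N) hk hk2 => k hk hk2.
set P := 2 ^ _; set M := \max_(n < _) f n.
have hN2 : 2 * c * M1 <= N /\ 2 * c <= N by lia.
have hM : M ^ (2 * c) <= 2 ^ N.
  apply: (big_ind (fun x => x ^ (2 * c) <= 2 ^ N)).
  - by rewrite exp0n ?expn_gt0 // muln_gt0.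
  - by move=> x y hx hy; rewrite /maxn; case: ifP.
  move=> [n hn] _ /=; rewrite ltnS in hn; have [h|h] := ltnP n N1.
    have h1 : f n <= M1 by apply: (leq_bigmax (Ordinal h)).
    have h2 : f n <= 2 ^ M1 by apply: leq_trans h1 (ltnW (ltn_expl _ _)).
    apply: (@leq_trans ((2 ^ M1) ^ (2 * c))); first by rewrite leq_exp2r // muln_gt0.
    by rewrite -expnM leq_pexp2l // mulnC; case: hN2.
  have := hN1 n h; rewrite expnM => hfn.
  have hlog : trunc_log 2 n <= 60 * k.
    by rewrite -(@trunc_expnK 2 (60 * k)) // leq_trunc_log.
  rewrite -(@leq_exp2r _ _ D) //; apply: leq_trans hfn _.
  rewrite -expnM leq_pexp2l //.
  apply: (@leq_trans ((60 * k) ^ 2)); first by rewrite leq_exp2r.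
  have hkN : k * k <= 4 * N by lia.
  rewrite -mulnn -hD mulnACA; apply: (@leq_trans (60 * 60 * (4 * N))).
    by rewrite leq_mul2l hkN orbT.
  by rewrite [X in _ <= X]mulnC mulnA.
have hPc : (2 * P) ^ c <= 2 ^ N.
  rewrite /P -expnS -expnM leq_pexp2l //.
  apply: (@leq_trans (2 * 360 * c * k)).
    have : (360 * k).+1 <= 2 * 360 * k by lia.
    by rewrite -(leq_pmul2r hc) -[2 * 360 * c * k]mulnA [c * k]mulnC mulnA.
  have [h|h] := leqP K k; last first.
    apply: (@leq_trans (2 * 360 * c * K)); last by lia.
    by rewrite leq_mul2l (ltnW h) orbT.
  have hKk : 8 * 360 * c * k <= k * k by rewrite leq_mul2r h orbT.
  clear - hKk hk2 hN; lia.
have hMc : (2 * M) ^ c <= 2 ^ N.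
  (* Squared, the claim splits into [2 ^ (2 * c) <= 2 ^ N] and [M ^ (2 * c) <= 2 ^ N]. *)
  rewrite -(@leq_exp2r _ _ 2) // -!expnM expnMn [c * 2]mulnC.
  apply: (@leq_trans (2 ^ N * 2 ^ N)); last by rewrite -expnD leq_pexp2l //; lia.
  by apply: leq_mul => //; rewrite leq_pexp2l //; case: hN2.
have [h|h] := leqP P M.
  apply: (@leq_trans ((2 * M) ^ c)) => //; rewrite leq_exp2r //.
  by rewrite mul2n -addnn leq_add2r.
apply: (@leq_trans ((2 * P) ^ c)) => //; rewrite leq_exp2r //.
by rewrite mul2n -addnn leq_add2l ltnW.
Qed.

Theorem theorem1 :
  ETH ->
  ~ exists (M : TM) (f : nat -> nat),
      quasi_sub f /\ decides_within M f valid_rtd enc_rtd rtd_size rtd_yes.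
Proof.
move=> eth [M [f [hf hM]]]; apply: eth.
exists (run_before M reduction 19 vO), (sat_time f); split.
  exact: sat_time_subexp.
exact: decides_sat.
Qed.
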